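(* Let $\omega=e^{2\pi i/6}$. For every oriented link $L$ in $S^3$, \[ \mathrm{ADO}_{\omega,L}(t)=\mathrm{LG}_L(t^2,\omega^2t^{-2}). \]
   Context: Braid group conventions: $B_n$ is the Artin braid group with standard generators $s_1,\dots,s_{n-1}$, $s_i$ being the crossing where strand $i$ passes over strand $i+1$. Link invariants from enhanced $R$-matrices: let $U$ be a finite-dimensional vector space with ordered basis $(u_1,\dots,u_m)$, write $u_{ij}=u_i\otimes u_j$, let $R\in\mathrm{End}(U\otimes U)$ be an invertible solution of the braid (Yang–Baxter) relation, and $h\in\mathrm{End}(U)$. Let $\rho_R:B_n\to GL(U^{\otimes n})$ send $s_i\mapsto \mathrm{id}^{\otimes(i-1)}\otimes R\otimes\mathrm{id}^{\otimes(n-i-1)}$. If the oriented link $L$ is the closure of $\beta\in B_n$, its invariant is $\frac{1}{\dim U}\mathrm{tr}\big((\mathrm{id}_U\otimes h^{\otimes(n-1)})\circ\rho_R(\beta)\big)$, which (for the pairs $(R,h)$ below) depends only on $L$. The Links--Gould invariant $\mathrm{LG}_L(t_0,t_1)$: $U=W$ with basis $(w_1,\dots,w_4)$ over $\mathbb{Q}(t_0^{1/2},t_1^{1/2},Y)$, $Y=\sqrt{(t_0-1)(1-t_1)}$, $h_{\mathrm{LG}}=\mathrm{diag}(t_0^{-1},-t_1,-t_0^{-1},t_1)$, and $R(w_{11})=t_0w_{11}$, $R(w_{12})=t_0^{1/2}w_{21}$, $R(w_{13})=t_0^{1/2}w_{31}$, $R(w_{14})=w_{41}$, $R(w_{21})=t_0^{1/2}w_{12}+(t_0-1)w_{21}$,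 $R(w_{22})=-w_{22}$, $R(w_{23})=(t_0t_1-1)w_{23}-t_0^{1/2}t_1^{1/2}w_{32}-t_0^{1/2}t_1^{1/2}Yw_{41}$, $R(w_{24})=t_1^{1/2}w_{42}$, $R(w_{31})=t_0^{1/2}w_{13}+(t_0-1)w_{31}$, $R(w_{32})=-t_0^{1/2}t_1^{1/2}w_{23}+Yw_{41}$, $R(w_{33})=-w_{33}$, $R(w_{34})=t_1^{1/2}w_{43}$, $R(w_{41})=w_{14}-t_0^{1/2}t_1^{1/2}Yw_{23}+Yw_{32}+Y^2w_{41}$, $R(w_{42})=t_1^{1/2}w_{24}+(t_1-1)w_{42}$, $R(w_{43})=t_1^{1/2}w_{34}+(t_1-1)w_{43}$, $R(w_{44})=t_1w_{44}$. The invariant $\mathrm{ADO}_{\omega,L}(t)$: $U=X$ with basis $(x_0,x_1,x_2)$ over $\mathbb{Q}(\omega,t)$, $h_{\mathrm{ADO}}=\mathrm{diag}(t^2,\omega^2t^2,\omega^4t^2)$, and $R(x_{00})=t^2x_{00}$, $R(x_{01})=(t^2-1)x_{01}+tx_{10}$, $R(x_{02})=(t^2-1)(1-\omega^2t^{-2})x_{02}+(t^{-1}+\omega t)x_{11}+x_{20}$, $R(x_{10})=tx_{01}$, $R(x_{11})=(t-t^{-1})x_{02}+\omega^2x_{11}$, $R(x_{12})=(\omega^2t^{-2}-1)x_{12}-\omega t^{-1}x_{21}$, $R(x_{20})=x_{02}$, $R(x_{21})=-\omega t^{-1}x_{12}$, $R(x_{22})=\omega^2t^{-2}x_{22}$.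 *)

(* Defs.v *)
From HB Require Import structures.
From mathcomp Require Import all_boot all_order all_algebra.
Set Implicit Arguments. Unset Strict Implicit. Unset Printing Implicit Defensive.
Import Order.TTheory GRing.Theory Num.Theory.
Local Open Scope ring_scope.

(* Braid words.  A braid word in B_n is a list of letters (k, b) : nat*bool *)
(* where the letter (k, true) stands for the standard generator s_{k+1}    *)
(* (strand k+1 passes over strand k+2, strands numbered 1..n) and          *)
(* (k, false) for its inverse s_{k+1}^{-1}.  The word is well formed for   *)
(* B_n iff every k satisfies k+1 < n.                                      *)
Definition braid_word := seq (nat * bool).
Definition wf_braid (n : nat) (w : braid_word) : bool := all (fun l => l.1.+1 < n)%N w.

Section EnhancedR.
Variable K : fieldType.

Definition mxo (T : finType) (f : T -> T -> K) : 'M[K]_#|T| :=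
  \matrix_(i, j) f (enum_val i) (enum_val j).

(* U has dimension m.+1, basis indexed by 'I_m.+1.  An endomorphism R of   *)
(* U (x) U is given by its coefficients: R a b c d is the coefficient of   *)
(* u_a (x) u_b in R(u_c (x) u_d).  An endomorphism h of U: h a c is the    *)
(* coefficient of u_a in h(u_c).                                           *)
Variable m : nat.
Variable R : 'I_m.+1 -> 'I_m.+1 -> 'I_m.+1 -> 'I_m.+1 -> K.
Variable h : 'I_m.+1 -> 'I_m.+1 -> K.

Definition Rpair (p q : 'I_m.+1 * 'I_m.+1) : K := R p.1 p.2 q.1 q.2.
Definition Rinvpair (p q : 'I_m.+1 * 'I_m.+1) : K :=
  invmx (mxo Rpair) (enum_rank p) (enum_rank q).

Variable n : nat.
(* basis of U^{(x) n}: u_{x_1} (x) ... (x) u_{x_n} *)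
Definition state := {ffun 'I_n -> 'I_m.+1}.

Definition get (x : state) (k : nat) : 'I_m.+1 :=
  if insub k is Some j then x j else ord0.

(* id^{(x) k} (x) f (x) id^{(x) (n-k-2)} *)
Definition local_op (f : 'I_m.+1 * 'I_m.+1 -> 'I_m.+1 * 'I_m.+1 -> K) (k : nat)
    (x y : state) : K :=
  f (get x k, get x k.+1) (get y k, get y k.+1) *
  ([forall j : 'I_n, ((val j != k) && (val j != k.+1)) ==> (x j == y j)])%:R.

Definition rho_letter (l : nat * bool) : 'M[K]_#|{: state}| :=
  mxo (local_op (if l.2 then Rpair else Rinvpair) l.1).

Definition rho (w : braid_word) : 'M[K]_#|{: state}| :=
  foldr (fun l M => rho_letter l *m M) 1%:M w.

(* id_U (x) h^{(x)(n-1)} *)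
Definition hop (x y : state) : K :=
  \prod_(j : 'I_n) (if val j == 0%N then (x j == y j)%:R else h (x j) (y j)).

Definition braid_invariant (w : braid_word) : K :=
  (m.+1%:R)^-1 * \tr (mxo hop *m rho w).

End EnhancedR.

Section Concrete.
Variable K : fieldType.

Definition ADO_coef (om t : K) (a b c d : nat) : K :=
  match c, d, a, b with
  | 0, 0, 0, 0 => t ^+ 2
  | 0, 1, 0, 1 => t ^+ 2 - 1
  | 0, 1, 1, 0 => t
  | 0, 2, 0, 2 => (t ^+ 2 - 1) * (1 - om ^+ 2 * t ^- 2)
  | 0, 2, 1, 1 => t^-1 + om * t
  | 0, 2, 2, 0 => 1
  | 1, 0, 0, 1 => t
  | 1, 1, 0, 2 => t - t^-1
  | 1, 1, 1, 1 => om ^+ 2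
  | 1, 2, 1, 2 => om ^+ 2 * t ^- 2 - 1
  | 1, 2, 2, 1 => - (om * t^-1)
  | 2, 0, 0, 2 => 1
  | 2, 1, 1, 2 => - (om * t^-1)
  | 2, 2, 2, 2 => om ^+ 2 * t ^- 2
  | _, _, _, _ => 0
  end.

Definition ADO_R (om t : K) (a b c d : 'I_3) : K := ADO_coef om t a b c d.
Definition ADO_h (om t : K) (a c : 'I_3) : K :=
  if a == c then om ^+ (2 * val a) * t ^+ 2 else 0.

Definition ADO (om t : K) (n : nat) (w : braid_word) : K :=
  braid_invariant (ADO_R om t) (ADO_h om t) n w.

(* Links--Gould: basis w_1..w_4 indexed by 0..3; parameters               *)
(* s0 = t0^{1/2}, s1 = t1^{1/2}, y = Y, so t0 = s0^2, t1 = s1^2.           *)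
Definition LG_coef (s0 s1 y : K) (a b c d : nat) : K :=
  let t0 := s0 ^+ 2 in let t1 := s1 ^+ 2 in
  match c, d, a, b with
  | 0, 0, 0, 0 => t0
  | 0, 1, 1, 0 => s0
  | 0, 2, 2, 0 => s0
  | 0, 3, 3, 0 => 1
  | 1, 0, 0, 1 => s0
  | 1, 0, 1, 0 => t0 - 1
  | 1, 1, 1, 1 => -1
  | 1, 2, 1, 2 => t0 * t1 - 1
  | 1, 2, 2, 1 => - (s0 * s1)
  | 1, 2, 3, 0 => - (s0 * s1 * y)
  | 1, 3, 3, 1 => s1
  | 2, 0, 0, 2 => s0
  | 2, 0, 2, 0 => t0 - 1
  | 2, 1, 1, 2 => - (s0 * s1)
  | 2, 1, 3, 0 => y
  | 2, 2, 2, 2 => -1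
  | 2, 3, 3, 2 => s1
  | 3, 0, 0, 3 => 1
  | 3, 0, 1, 2 => - (s0 * s1 * y)
  | 3, 0, 2, 1 => y
  | 3, 0, 3, 0 => y ^+ 2
  | 3, 1, 1, 3 => s1
  | 3, 1, 3, 1 => t1 - 1
  | 3, 2, 2, 3 => s1
  | 3, 2, 3, 2 => t1 - 1
  | 3, 3, 3, 3 => t1
  | _, _, _, _ => 0
  end.

Definition LG_R (s0 s1 y : K) (a b c d : 'I_4) : K := LG_coef s0 s1 y a b c d.
Definition LG_h (s0 s1 : K) (a c : 'I_4) : K :=
  if a == c then
    match val a with
    | 0 => (s0 ^+ 2)^-1
    | 1 => - s1 ^+ 2
    | 2 => - (s0 ^+ 2)^-1
    | _ => s1 ^+ 2
    end
  else 0.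

Definition LG (s0 s1 y : K) (n : nat) (w : braid_word) : K :=
  braid_invariant (LG_R s0 s1 y) (LG_h s0 s1) n w.

End Concrete.

(* Main.v *)
(** Write [W = 1 + V + 1] for the Links-Gould module, [V] being spanned by the two middle
    basis vectors.  The blocks of its R-matrix are Temperley-Lieb operators on the copies
    of [V]; when [t0 t1 = om ^+ 2] the loop value is [om] and equals, up to a sign, the
    zigzag constant, so the Temperley-Lieb category has a one-dimensional functor.  It
    turns the Links-Gould R-matrix into the ADO R-matrix, up to a diagonal gauge and with
    the order of the strands reversed.  Since every closed Temperley-Lieb diagram is
    determined by its image under the functor, the Links-Gould invariant of a braid is
    the ADO trace of the reversed braid with the last strand left open.

    It remains to undo the reversal.  Braid operators commute with a raising and a
    lowering operator, and so do their partial closures; on two strands this leaves three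
    parameters, and one checks that closing the left or the right strand gives the same
    scalar.  Hence the ADO trace does not depend on which strand is open nor on its label,
    it is invariant under conjugation, and conjugation by the half twist reverses the
    order of the strands. *)

Require Import Defs.
From HB Require Import structures.
From mathcomp Require Import all_boot all_order all_algebra.
From mathcomp Require Import zify ring.
Set Implicit Arguments. Unset Strict Implicit. Unset Printing Implicit Defensive.
Import GRing.Theory.
Local Open Scope ring_scope.

(** * Operators on lists of basis labels *)

(** The obstacle is that the ADO weights of one strand sum to zero ([1 + om^2 + om^4 = 0]), so one
    strand must stay open, and a weight that omits a strand commutes only with the letters that
    avoid this strand. Conjugation invariance is therefore not automatic. It comes from moving the
    opening: with at least three strands, every letter misses the first or the last one.
    Independence of the open label is also what reconciles the normalisations 1/3 and 1/4: each
    basis vector of the open strand contributes the same scalar.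

    The image of a tensor under the one-dimensional functor is carried next to the tensor in the
    relation [TL], and a value is read off only in degrees 0 and 2, where there is a single cup
    diagram.

    The roots [s0] and [s1] are arbitrary, which leaves two signs [e0] and [eta] with [s0 = e0 t]
    and [s0 s1 = - eta om]; the gauge absorbs them.

    Inverse letters are never compared entry by entry: what commutes with R commutes with its
    inverse, and both inverse R-matrices are the same polynomial in their R-matrices. *)

Definition valid (m n : nat) (s : seq nat) : bool :=
  (size s == n) && all (gtn m) s.

Lemma valid_cons m n a s : valid m n.+1 (a :: s) = (a < m)%N && valid m n s.
Proof. by rewrite /valid /= eqSS; case: (a < m)%N; rewrite /= ?andbF. Qed.

Lemma valid_rcons m n a s : valid m n.+1 (rcons s a) = (a < m)%N && valid m n s.
Proof.
by rewrite /valid size_rcons all_rcons eqSS /=; case: (a < m)%N; rewrite /= ?andbF.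
Qed.

Lemma valid_rev m n s : valid m n (rev s) = valid m n s.
Proof. by rewrite /valid size_rev all_rev. Qed.

Lemma valid_ctx m n s1 a b s2 c d :
  valid m n (s1 ++ a :: b :: s2) -> (c < m)%N -> (d < m)%N ->
  valid m n (s1 ++ c :: d :: s2).
Proof.
rewrite /valid !size_cat !all_cat /= => /andP [-> /and4P [-> _ _ ->]] hc hd.
by rewrite hc hd.
Qed.

Lemma valid_split m n k s : valid m n s -> (k.+1 < n)%N ->
  exists s1 a b s2, [/\ s = s1 ++ a :: b :: s2, size s1 = k, (a < m)%N & (b < m)%N].
Proof.
case/andP=> /eqP sz al lt; exists (take k s), (nth 0 s k), (nth 0 s k.+1), (drop k.+2 s).
rewrite -!drop_nth ?sz ?(ltnW lt) // cat_take_drop size_takel ?sz; last by lia.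
by split=> //; apply: (allP al); rewrite mem_nth // sz // ltnW.
Qed.

Section Operators.
Variable K : fieldType.
Implicit Types (phi psi : seq nat -> K).

Fixpoint lsum (m n : nat) (f : seq nat -> K) : K :=
  if n is n'.+1 then \sum_(c < m) lsum m n' (fun s => f (val c :: s)) else f [::].

Lemma eq_lsum m n f g : (forall s, valid m n s -> f s = g s) ->
  lsum m n f = lsum m n g.
Proof.
elim: n f g => [|n IH] f g fg /=; first exact: fg.
by apply: eq_bigr => c _; apply: IH => s vs; apply: fg; rewrite valid_cons ltn_ord.
Qed.

Lemma lsum_distr m n a f : lsum m n (fun s => a * f s) = a * lsum m n f.
Proof.
elim: n f => [|n IH] f //=; rewrite mulr_sumr.
by apply: eq_bigr => c _; rewrite IH.
Qed.

Lemma lsum_rcons m n f :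
  lsum m n.+1 f = \sum_(c < m) lsum m n (fun s => f (rcons s (val c))).
Proof.
elim: n f => [|n IH] f //.
transitivity (\sum_(c < m) \sum_(d < m) lsum m n (fun s => f (val c :: rcons s (val d)))).
  by apply: eq_bigr => c _; rewrite -[RHS](IH (fun s => f (val c :: s))).
by rewrite exchange_big.
Qed.

Lemma lsum_rev m n f : lsum m n (fun s => f (rev s)) = lsum m n f.
Proof.
elim: n f => [|n IH] f; first by [].
rewrite lsum_rcons /=; apply: eq_bigr => c _; rewrite -[RHS](IH (fun s => f (val c :: s))).
by apply: eq_lsum => s _; rewrite rev_rcons.
Qed.

Definition delta (z s : seq nat) : K := (s == z)%:R.

Section Letters.
Variable m : nat.
Local Notation I := 'I_m.+1.
Local Notation kernel := (I * I -> I * I -> K).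
Implicit Types f g : kernel.

(** Matrix times column vector: [s] is the row index and [phi] the vector. The default values of
    [nth] and [inord] are harmless on valid lists, hence the [valid] hypotheses in what follows. *)
Definition lop f k phi (s : seq nat) : K :=
  \sum_(p : I * I) f (inord (nth 0 s k), inord (nth 0 s k.+1)) p *
    phi (take k s ++ val p.1 :: val p.2 :: drop k.+2 s).

Lemma lopE f phi s1 a b s2 :
  lop f (size s1) phi (s1 ++ a :: b :: s2) =
  \sum_(p : I * I) f (inord a, inord b) p * phi (s1 ++ val p.1 :: val p.2 :: s2).
Proof.
rewrite /lop !nth_cat ltnn subnn ltnNge leqnSn /= subSnn /=.
rewrite take_size_cat // drop_cat ltnNge -addn2 leq_addr /= addKn /=.
by rewrite drop0.
Qed.

Variable n : nat.

Lemma eq_lop f k phi psi s : (k.+1 < n)%N ->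
  (forall s, valid m.+1 n s -> phi s = psi s) ->
  valid m.+1 n s -> lop f k phi s = lop f k psi s.
Proof.
move=> lt e vs; have [s1 [a [b [s2 [es <- _ _]]]]] := valid_split vs lt.
rewrite es in vs *; rewrite !lopE; apply: eq_bigr => p _; rewrite e //.
exact: valid_ctx vs (ltn_ord _) (ltn_ord _).
Qed.

Definition kcomp f g : kernel := fun p q => \sum_r f p r * g r q.

Lemma lop_comp f g k phi s : (k.+1 < n)%N -> valid m.+1 n s ->
  lop f k (lop g k phi) s = lop (kcomp f g) k phi s.
Proof.
move=> lt vs; have [s1 [a [b [s2 [-> <- _ _]]]]] := valid_split vs lt.
rewrite !lopE; under eq_bigr => p _ do rewrite lopE !inord_val -surjective_pairing mulr_sumr.
rewrite exchange_big; apply: eq_bigr => q _; rewrite mulr_suml.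
by apply: eq_bigr => p _; rewrite mulrA.
Qed.

Lemma lop_id f k phi s : (forall p q, f p q = (p == q)%:R) -> (k.+1 < n)%N ->
  valid m.+1 n s -> lop f k phi s = phi s.
Proof.
move=> e lt vs; have [s1 [a [b [s2 [-> <- la lb]]]]] := valid_split vs lt.
rewrite lopE (bigD1 (inord a, inord b)) //= e eqxx mul1r big1 ?addr0 ?inordK //.
by move=> p /negPf hp; rewrite e eq_sym hp mul0r.
Qed.

Lemma lop_scale f k c phi s : lop f k (fun s => c * phi s) s = c * lop f k phi s.
Proof. by rewrite /lop mulr_sumr; apply: eq_bigr => p _; rewrite mulrCA. Qed.

End Letters.

(** * Matrix entries and weighted traces of braid operators on lists *)

Section Evaluation.
Variables (m n : nat) (R : 'I_m.+1 -> 'I_m.+1 -> 'I_m.+1 -> 'I_m.+1 -> K).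
Local Notation I := 'I_m.+1.
Local Notation State := (state m n).

Definition letter_kernel (b : bool) : I * I -> I * I -> K :=
  if b then Rpair R else Rinvpair R.

Definition ev (w : braid_word) phi : seq nat -> K :=
  foldr (fun l psi => lop (letter_kernel l.2) l.1 psi) phi w.

Definition letters (x : State) : seq nat := [seq val (x i) | i <- enum 'I_n].
Definition of_letters (s : seq nat) : State := [ffun i : 'I_n => inord (nth 0 s i)].

Lemma valid_letters x : valid m.+1 n (letters x).
Proof.
rewrite /valid size_map size_enum_ord eqxx /=.
by apply/allP => _ /mapP [i _ ->]; exact: ltn_ord.
Qed.

Lemma nth_letters x (i : 'I_n) : nth 0%N (letters x) i = x i.
Proof. by rewrite (nth_map i) ?size_enum_ord // nth_ord_enum. Qed.

Lemma lettersK x : of_letters (letters x) = x.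
Proof. by apply/ffunP => i; rewrite ffunE nth_letters inord_val. Qed.

Lemma of_lettersK s : valid m.+1 n s -> letters (of_letters s) = s.
Proof.
move=> vs; case/andP: (vs) => /eqP sz al.
apply: (@eq_from_nth _ 0%N); first by rewrite size_map size_enum_ord.
move=> i; rewrite size_map size_enum_ord => lt.
rewrite (nth_letters _ (Ordinal lt)) ffunE /= inordK //.
by apply: (allP al); rewrite mem_nth // sz.
Qed.

Definition words := iter n (fun ws => [seq c :: s | c <- iota 0 m.+1, s <- ws]) [:: [::]].

Lemma lsum_state (f : seq nat -> K) : \sum_(x : State) f (letters x) = lsum m.+1 n f.
Proof.
have -> : lsum m.+1 n f = \sum_(s <- words) f s.
  rewrite /words; elim: n f => [|n' IH] f; first by rewrite /= big_seq1.
  rewrite iterS big_flatten big_map -[iota _ _]/(index_iota 0 m.+1) big_mkord /=.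
  by apply: eq_bigr => c _; rewrite IH big_map.
rewrite -big_enum -(big_map letters xpredT f); apply: perm_big.
have memw k s : (s \in iter k (fun ws => [seq c :: s | c <- iota 0 m.+1, s <- ws]) [:: [::]])
                = valid m.+1 k s.
  elim: k s => [|k IH] s; first by rewrite /= inE /valid; case: s.
  rewrite iterS; apply/allpairsP/idP => [[[c s'] [hc hs ->]]|].
    by move: hc hs; rewrite mem_iota IH valid_cons => /= -> ->.
  case: s => [//|c s]; rewrite valid_cons => /andP [hc hs].
  by exists (c, s); rewrite mem_iota IH.
apply: uniq_perm.
- by rewrite map_inj_uniq ?enum_uniq // => x y e; rewrite -[x]lettersK e lettersK.
- rewrite /words; elim: n => [|k IH] //; rewrite iterS allpairs_uniq ?iota_uniq //.
  by move=> [a b] [c d] _ _ /= [-> ->].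
move=> s; rewrite memw; apply/mapP/idP => [[x _ ->]|vs]; first exact: valid_letters.
by exists (of_letters s); rewrite ?mem_enum ?of_lettersK.
Qed.

Definition entry (A : 'M[K]_#|{: State}|) (s z : seq nat) : K :=
  A (enum_rank (of_letters s)) (enum_rank (of_letters z)).

Lemma entry_inj A B :
  (forall s z, valid m.+1 n s -> valid m.+1 n z -> entry A s z = entry B s z) -> A = B.
Proof.
move=> e; apply/matrixP => i j.
have := e _ _ (valid_letters (enum_val i)) (valid_letters (enum_val j)).
by rewrite /entry !lettersK !enum_valK.
Qed.

Lemma entry1 s z : valid m.+1 n s -> valid m.+1 n z -> entry 1%:M s z = delta z s.
Proof.
move=> vs vz; rewrite /entry mxE (inj_eq enum_rank_inj) /delta; congr ((nat_of_bool _)%:R).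
by apply/eqP/eqP => [e|-> //]; rewrite -(of_lettersK vs) e of_lettersK.
Qed.

Lemma get_of_letters k s : (k < n)%N -> get (of_letters s) k = inord (nth 0 s k).
Proof. by move=> lt; rewrite /get insubT ffunE. Qed.

Lemma entry_letter l A s z : (l.1.+1 < n)%N -> valid m.+1 n s ->
  entry (rho_letter R n l *m A) s z =
  lop (letter_kernel l.2) l.1 (fun s' => entry A s' z) s.
Proof.
case: l => k b /= lt vs; rewrite /entry mxE.
set f := letter_kernel b.
have -> : \sum_j rho_letter R n (k, b) (enum_rank (of_letters s)) j *
    A j (enum_rank (of_letters z)) =
  \sum_(y : State) local_op f k (of_letters s) y * A (enum_rank y) (enum_rank (of_letters z)).
  rewrite (reindex _ (onW_bij _ (enum_rank_bij State))) /=; apply: eq_bigr => y _.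
  by rewrite /rho_letter /mxo mxE !enum_rankK.
have [s1 [a [b' [s2 [es sz la lb]]]]] := valid_split vs lt.
have [/eqP szs _] := andP vs.
rewrite es -[in RHS]sz lopE -es.
rewrite (partition_big (fun y : State => (get y k, get y k.+1)) xpredT) //=.
apply: eq_bigr => -[c d] _ /=.
have lt0 := ltnW lt.
set s' := s1 ++ val c :: val d :: s2.
have vs' : valid m.+1 n s' by move: vs; rewrite es => /valid_ctx; apply; exact: ltn_ord.
have gs : get (of_letters s) k = inord a /\ get (of_letters s) k.+1 = inord b'.
  rewrite !get_of_letters // es !nth_cat sz ltnn subnn ltnNge leqnSn /= subSnn /=.
  by split.
have gs' : get (of_letters s') k = c /\ get (of_letters s') k.+1 = d.
  rewrite !get_of_letters // !nth_cat sz ltnn subnn ltnNge leqnSn /= subSnn /=.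
  by rewrite !inord_val.
have nthe (i : nat) : i != k -> i != k.+1 -> nth 0%N s i = nth 0%N s' i.
  rewrite es /s' !nth_cat sz => i1 i2; case: ltnP => // h.
  by have -> : (i - k = (i - k - 2).+2)%N by lia.
rewrite (bigD1 (of_letters s')) /=; last by rewrite gs'.1 gs'.2.
rewrite big1 ?addr0; last first.
  move=> y /andP [/eqP [gy1 gy2] ne]; rewrite /local_op.
  case: forallP => [h|_]; last by rewrite mulr0 mul0r.
  case/eqP: ne; apply/ffunP => i.
  have getE (x : State) : get x i = x i.
    by rewrite /get insubT //= => p; congr (x _); apply: val_inj.
  have := h i; have [ik _|nk] := eqVneq (val i) k.
    by rewrite -!getE ik gs'.1 gy1.
  have [ik _|nk1] := eqVneq (val i) k.+1; first by rewrite -!getE ik gs'.2 gy2.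
  by move=> /= /eqP <-; rewrite !ffunE nthe.
rewrite /local_op gs.1 gs.2 gs'.1 gs'.2; congr (_ * _).
case: forallP => [_|[]]; first by rewrite mulr1.
by move=> i; apply/implyP => /andP [i1 i2]; rewrite !ffunE nthe.
Qed.

Lemma entry_rho w s z : wf_braid n w -> valid m.+1 n s -> valid m.+1 n z ->
  entry (rho R n w) s z = ev w (delta z) s.
Proof.
move=> hw vs vz; elim: w s hw vs => [|l w IH] s /=; first by move=> _ vs; exact: entry1.
case/andP=> hl hw vs; rewrite entry_letter //.
by apply: (eq_lop (n := n)) => // s' vs'; exact: IH.
Qed.

Lemma rho_cat w1 w2 : rho R n (w1 ++ w2) = rho R n w1 *m rho R n w2.
Proof. by elim: w1 => [|l w IH] /=; rewrite ?mul1mx // IH mulmxA. Qed.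

Definition diagm (f : seq nat -> K) : 'M[K]_#|{: State}| :=
  mxo (fun x y : State => f (letters x) * (x == y)%:R).

Lemma entry_diagm f A s z : valid m.+1 n s ->
  entry (diagm f *m A) s z = f s * entry A s z.
Proof.
move=> vs; rewrite /entry mxE (bigD1 (enum_rank (of_letters s))) //= !mxE eqxx mulr1.
rewrite enum_rankK of_lettersK // big1 ?addr0 // => k nk; rewrite !mxE enum_rankK.
suff /negPf -> : of_letters s != enum_val k by rewrite mulr0 mul0r.
by apply: contraNneq nk => ->; rewrite enum_valK.
Qed.

Lemma mxtrace_diagm f A : \tr (diagm f *m A) = lsum m.+1 n (fun s => f s * entry A s s).
Proof.
rewrite /mxtrace -lsum_state (reindex _ (onW_bij _ (enum_rank_bij State))) /=.
by apply: eq_bigr => x _; rewrite -entry_diagm ?valid_letters // /entry lettersK.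
Qed.

Lemma diagm_comm f l : (l.1.+1 < n)%N ->
  (forall phi s, valid m.+1 n s ->
     f s * lop (letter_kernel l.2) l.1 phi s =
     lop (letter_kernel l.2) l.1 (fun s' => f s' * phi s') s) ->
  diagm f *m rho_letter R n l = rho_letter R n l *m diagm f.
Proof.
move=> hl comm; apply: entry_inj => s z vs vz.
rewrite entry_diagm // -[rho_letter R n l in LHS]mulmx1 !entry_letter // comm //.
apply: (eq_lop (n := n)) => // s' vs'.
by rewrite -[diagm f]mulmx1 entry_diagm.
Qed.

Lemma hop_diag (h : I -> I -> K) (hd : nat -> K) :
  (forall a c, h a c = if a == c then hd a else 0) -> (0 < n)%N ->
  mxo (hop h (n := n)) = diagm (fun s => \prod_(a <- behead s) hd a).
Proof.
move=> hE n0; apply/matrixP => i j; rewrite !mxE.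
move: (enum_val i) (enum_val j) => x y; rewrite /hop.
have [<-|ne] := eqVneq x y; last first.
  have [k nk] : exists k, x k != y k.
    by apply/existsP; apply: contraR ne; rewrite negb_exists => /forallP h';
       apply/eqP/ffunP => k; apply/eqP; rewrite -[_ == _]negbK.
  rewrite mulr0 (bigD1 k) //= hE (negPf nk); by case: ifP; rewrite mul0r.
rewrite mulr1 /letters; case: n n0 x {y i j} => // n' _ x.
rewrite enum_ordSl /= big_map big_map big_enum big_ord_recl /= eqxx mul1r.
by apply: eq_bigr => k _; rewrite hE eqxx.
Qed.

End Evaluation.
End Operators.

(** * Inverse letters and explicit R-matrices *)

Section Inverse.
Variables (K : fieldType) (m n : nat).
Local Notation I := 'I_m.+1.

Lemma mxo_mul (f g : I * I -> I * I -> K) : mxo f *m mxo g = mxo (kcomp f g).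
Proof.
apply/matrixP => i j; rewrite !mxE (reindex _ (onW_bij _ (enum_rank_bij _))) /=.
by apply: eq_bigr => r _; rewrite !mxE enum_rankK.
Qed.

Lemma mxo_id (f : I * I -> I * I -> K) :
  (forall p q, f p q = (p == q)%:R) -> mxo f = 1%:M.
Proof. by move=> e; apply/matrixP => i j; rewrite !mxE e (inj_eq enum_val_inj). Qed.

Lemma mxo_unit (f g : I * I -> I * I -> K) :
  (forall p q, kcomp f g p q = (p == q)%:R) -> mxo f \in unitmx.
Proof. by move=> e; apply: (mulmx1_unit (B := mxo g) _).1; rewrite mxo_mul mxo_id. Qed.

Variable R : I -> I -> I -> I -> K.
Hypothesis R_unit : mxo (Rpair R) \in unitmx.

Lemma mxo_Rinvpair : mxo (Rinvpair R) = invmx (mxo (Rpair R)).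
Proof. by apply/matrixP => i j; rewrite mxE /Rinvpair !enum_valK. Qed.

Lemma mxo1_inv (f : I * I -> I * I -> K) :
  mxo f = 1%:M -> forall p q, f p q = (p == q)%:R.
Proof.
move=> /matrixP e p q; have := e (enum_rank p) (enum_rank q).
by rewrite !mxE !enum_rankK (inj_eq enum_rank_inj).
Qed.

Lemma lop_RK k phi s : (k.+1 < n)%N -> valid m.+1 n s ->
  lop (Rpair R) k (lop (Rinvpair R) k phi) s = phi s.
Proof.
move=> hk vs; rewrite (lop_comp (n := n)) // (lop_id (n := n)) //.
by apply: mxo1_inv; rewrite -mxo_mul mxo_Rinvpair mulmxV.
Qed.

Lemma lop_RVK k phi s : (k.+1 < n)%N -> valid m.+1 n s ->
  lop (Rinvpair R) k (lop (Rpair R) k phi) s = phi s.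
Proof.
move=> hk vs; rewrite (lop_comp (n := n)) // (lop_id (n := n)) //.
by apply: mxo1_inv; rewrite -mxo_mul mxo_Rinvpair mulVmx.
Qed.

Lemma rho_letterK k b : (k.+1 < n)%N ->
  rho_letter R n (k, b) *m rho_letter R n (k, ~~ b) = 1%:M.
Proof.
move=> hk; apply: entry_inj => s z vs vz.
rewrite -[rho_letter R n (k, ~~ b)]mulmx1 !entry_letter //=.
transitivity (lop (letter_kernel R b) k (lop (letter_kernel R (~~ b)) k
  (fun s' => @entry K m n 1%:M s' z)) s).
  by apply: (eq_lop (n := n)) => // s' vs'; rewrite entry_letter.
by case: b => /=; rewrite ?lop_RK ?lop_RVK.
Qed.

Definition inv_word (w : braid_word) : braid_word := rev [seq (l.1, ~~ l.2) | l <- w].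

Lemma wf_inv_word w : wf_braid n (inv_word w) = wf_braid n w.
Proof. by rewrite /wf_braid /inv_word all_rev all_map. Qed.

Lemma rho_inv_word w : wf_braid n w -> rho R n w *m rho R n (inv_word w) = 1%:M.
Proof.
elim: w => [|[k b] w IH] /=; first by rewrite mul1mx.
case/andP=> hk /IH e; rewrite /inv_word /= rev_cons -cats1 rho_cat /= mulmx1.
by rewrite -mulmxA (mulmxA (rho R n w)) e mul1mx rho_letterK.
Qed.

(** An operator that commutes with R commutes with its inverse, so each symmetry is checked on
    positive letters only. *)
Lemma commutes_letter (O : (seq nat -> K) -> seq nat -> K) k b :
  (k.+1 < n)%N ->
  (forall phi psi, (forall s, valid m.+1 n s -> phi s = psi s) ->
     forall s, valid m.+1 n s -> O phi s = O psi s) ->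
  (forall phi s, valid m.+1 n s -> O (lop (Rpair R) k phi) s = lop (Rpair R) k (O phi) s) ->
  forall phi s, valid m.+1 n s ->
    O (lop (letter_kernel R b) k phi) s = lop (letter_kernel R b) k (O phi) s.
Proof.
move=> hk eqO comm; case: b => //= phi s vs.
rewrite -[LHS](lop_RVK _ hk vs); apply: (eq_lop (n := n)) => // s' vs'.
by rewrite -comm //; apply: eqO => // s'' vs''; rewrite lop_RK.
Qed.

End Inverse.

Section Rows.
Variable K : fieldType.

(** Read along a row [(a, b)], while [ADO_coef] lists the images of basis vectors, that is,
    columns. *)
Definition ADO_row (om t : K) (a b : nat) (phi : nat -> nat -> K) : K :=
  match a, b with
  | 0, 0 => t ^+ 2 * phi 0%N 0%N
  | 0, 1 => (t ^+ 2 - 1) * phi 0%N 1%N + t * phi 1%N 0%N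
  | 1, 0 => t * phi 0%N 1%N
  | 0, 2 => (t ^+ 2 - 1) * (1 - om ^+ 2 * t ^- 2) * phi 0%N 2%N + (t - t^-1) * phi 1%N 1%N
            + phi 2%N 0%N
  | 1, 1 => (t^-1 + om * t) * phi 0%N 2%N + om ^+ 2 * phi 1%N 1%N
  | 2, 0 => phi 0%N 2%N
  | 1, 2 => (om ^+ 2 * t ^- 2 - 1) * phi 1%N 2%N - om * t^-1 * phi 2%N 1%N
  | 2, 1 => - (om * t^-1) * phi 1%N 2%N
  | 2, 2 => om ^+ 2 * t ^- 2 * phi 2%N 2%N
  | _, _ => 0
  end.

Definition ADO_row_inv (om t : K) (a b : nat) (phi : nat -> nat -> K) : K :=
  match a, b with
  | 0, 0 => t ^- 2 * phi 0%N 0%N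
  | 0, 1 => t^-1 * phi 1%N 0%N
  | 1, 0 => t^-1 * phi 0%N 1%N - (1 - t ^- 2) * phi 1%N 0%N
  | 0, 2 => phi 2%N 0%N
  | 1, 1 => om ^- 2 * phi 1%N 1%N - om ^- 2 * (t^-1 + om * t) * phi 2%N 0%N
  | 2, 0 => phi 0%N 2%N - (t ^+ 2 - 1) * (1 - om ^+ 2 * t ^- 2) * phi 2%N 0%N
            - (t - t^-1) * om ^- 2 * (phi 1%N 1%N - (t^-1 + om * t) * phi 2%N 0%N)
  | 1, 2 => - (om^-1 * t) * phi 2%N 1%N
  | 2, 1 => - (om^-1 * t) * phi 1%N 2%N
            + (om^-1 * t) ^+ 2 * (1 - om ^+ 2 * t ^- 2) * phi 2%N 1%N
  | 2, 2 => om ^- 2 * t ^+ 2 * phi 2%N 2%N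
  | _, _ => 0
  end.

Definition LG_row (s0 s1 y : K) (a b : nat) (phi : nat -> nat -> K) : K :=
  let t0 := s0 ^+ 2 in let t1 := s1 ^+ 2 in
  match a, b with
  | 0, 0 => t0 * phi 0%N 0%N
  | 0, 1 => s0 * phi 1%N 0%N
  | 1, 0 => s0 * phi 0%N 1%N + (t0 - 1) * phi 1%N 0%N
  | 0, 2 => s0 * phi 2%N 0%N
  | 2, 0 => s0 * phi 0%N 2%N + (t0 - 1) * phi 2%N 0%N
  | 1, 1 => - phi 1%N 1%N
  | 2, 2 => - phi 2%N 2%N
  | 0, 3 => phi 3%N 0%N
  | 1, 2 => (t0 * t1 - 1) * phi 1%N 2%N - s0 * s1 * phi 2%N 1%N - s0 * s1 * y * phi 3%N 0%N
  | 2, 1 => - (s0 * s1) * phi 1%N 2%N + y * phi 3%N 0%N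
  | 3, 0 => phi 0%N 3%N - s0 * s1 * y * phi 1%N 2%N + y * phi 2%N 1%N + y ^+ 2 * phi 3%N 0%N
  | 1, 3 => s1 * phi 3%N 1%N
  | 3, 1 => s1 * phi 1%N 3%N + (t1 - 1) * phi 3%N 1%N
  | 2, 3 => s1 * phi 3%N 2%N
  | 3, 2 => s1 * phi 2%N 3%N + (t1 - 1) * phi 3%N 2%N
  | 3, 3 => t1 * phi 3%N 3%N
  | _, _ => 0
  end.

Definition LG_row_inv (s0 s1 y : K) (a b : nat) (phi : nat -> nat -> K) : K :=
  let t0 := s0 ^+ 2 in let t1 := s1 ^+ 2 in let s := s0 * s1 in
  match a, b with
  | 0, 0 => t0^-1 * phi 0%N 0%N
  | 0, 1 => s0^-1 * phi 1%N 0%N - (1 - t0^-1) * phi 0%N 1%N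
  | 1, 0 => s0^-1 * phi 0%N 1%N
  | 0, 2 => s0^-1 * phi 2%N 0%N - (1 - t0^-1) * phi 0%N 2%N
  | 2, 0 => s0^-1 * phi 0%N 2%N
  | 1, 1 => - phi 1%N 1%N
  | 2, 2 => - phi 2%N 2%N
  | 3, 0 => phi 0%N 3%N
  | 0, 3 => phi 3%N 0%N + y ^+ 2 * s ^- 2 * phi 0%N 3%N - y * s ^- 2 * phi 2%N 1%N
            + y * s^-1 * phi 1%N 2%N
  | 1, 2 => y * s^-1 * phi 0%N 3%N - s^-1 * phi 2%N 1%N
  | 2, 1 => - (y * s ^- 2) * phi 0%N 3%N - (1 - s ^- 2) * phi 2%N 1%N - s^-1 * phi 1%N 2%N
  | 1, 3 => s1^-1 * phi 3%N 1%N - (1 - t1^-1) * phi 1%N 3%N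
  | 3, 1 => s1^-1 * phi 1%N 3%N
  | 2, 3 => s1^-1 * phi 3%N 2%N - (1 - t1^-1) * phi 2%N 3%N
  | 3, 2 => s1^-1 * phi 2%N 3%N
  | 3, 3 => t1^-1 * phi 3%N 3%N
  | _, _ => 0
  end.

Lemma sum_ADO_R (om t : K) (a b : 'I_3) (phi : nat -> nat -> K) :
  \sum_(p : 'I_3 * 'I_3) Rpair (ADO_R om t) (a, b) p * phi p.1 p.2 =
  ADO_row om t a b phi.
Proof.
rewrite -(pair_bigA _ (fun c d => Rpair (ADO_R om t) (a, b) (c, d) * phi c d)) /=.
rewrite /Rpair /ADO_R /=; case: a b => [a la] [b lb] /=.
rewrite !big_ord_recl !big_ord0 /= /bump /=.
by do 3?[case: a la => [|a] la //]; do 3?[case: b lb => [|b] lb //]; rewrite /=; ring.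
Qed.

Lemma sum_LG_R (s0 s1 y : K) (a b : 'I_4) (phi : nat -> nat -> K) :
  \sum_(p : 'I_4 * 'I_4) Rpair (LG_R s0 s1 y) (a, b) p * phi p.1 p.2 =
  LG_row s0 s1 y a b phi.
Proof.
rewrite -(pair_bigA _ (fun c d => Rpair (LG_R s0 s1 y) (a, b) (c, d) * phi c d)) /=.
rewrite /Rpair /LG_R /=; case: a b => [a la] [b lb] /=.
rewrite !big_ord_recl !big_ord0 /= /bump /=.
by do 4?[case: a la => [|a] la //]; do 4?[case: b lb => [|b] lb //]; rewrite /=; ring.
Qed.

Lemma lop_ADO (om t : K) s1 a b s2 phi : (a < 3)%N -> (b < 3)%N ->
  lop (Rpair (ADO_R om t)) (size s1) phi (s1 ++ a :: b :: s2) =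
  ADO_row om t a b (fun c d => phi (s1 ++ c :: d :: s2)).
Proof.
move=> la lb; rewrite lopE.
by rewrite (sum_ADO_R _ _ _ _ (fun c d => phi (s1 ++ c :: d :: s2))) !inordK.
Qed.

Lemma lop_LG (s0 s1 y : K) u1 a b u2 phi : (a < 4)%N -> (b < 4)%N ->
  lop (Rpair (LG_R s0 s1 y)) (size u1) phi (u1 ++ a :: b :: u2) =
  LG_row s0 s1 y a b (fun c d => phi (u1 ++ c :: d :: u2)).
Proof.
move=> la lb; rewrite lopE.
by rewrite (sum_LG_R _ _ _ _ _ (fun c d => phi (u1 ++ c :: d :: u2))) !inordK.
Qed.

End Rows.

(** * Invertibility of both R-matrices and the braid relation for ADO *)

Section Units.
Variable K : fieldType.

Lemma ADO_rowK (om t : K) a b psi : om != 0 -> t != 0 -> (a < 3)%N -> (b < 3)%N ->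
  ADO_row om t a b (fun c d => ADO_row_inv om t c d psi) = psi a b.
Proof.
move=> om0 t0 la lb.
by do 3?[case: a la => [|a] la //]; do 3?[case: b lb => [|b] lb //]; rewrite /=; field;
   rewrite ?om0 ?t0.
Qed.

Lemma LG_rowK (s0 s1 y : K) a b psi : s0 != 0 -> s1 != 0 -> (a < 4)%N -> (b < 4)%N ->
  LG_row s0 s1 y a b (fun c d => LG_row_inv s0 s1 y c d psi) = psi a b.
Proof.
move=> s00 s10 la lb.
by do 4?[case: a la => [|a] la //]; do 4?[case: b lb => [|b] lb //]; rewrite /=; field;
   rewrite ?s00 ?s10.
Qed.

Lemma ADO_unit (om t : K) : om != 0 -> t != 0 -> mxo (Rpair (ADO_R om t)) \in unitmx.
Proof.
move=> om0 t0; pose ind (q : 'I_3 * 'I_3) c d : K := ((c == q.1 :> nat) && (d == q.2 :> nat))%:R.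
apply: (mxo_unit (g := fun p q => ADO_row_inv om t p.1 p.2 (ind q))) => -[a b] q.
rewrite /kcomp (sum_ADO_R _ _ _ _ (fun c d => ADO_row_inv om t c d (ind q))).
by rewrite ADO_rowK.
Qed.

Lemma LG_unit (s0 s1 y : K) : s0 != 0 -> s1 != 0 -> mxo (Rpair (LG_R s0 s1 y)) \in unitmx.
Proof.
move=> s00 s10; pose ind (q : 'I_4 * 'I_4) c d : K := ((c == q.1 :> nat) && (d == q.2 :> nat))%:R.
apply: (mxo_unit (g := fun p q => LG_row_inv s0 s1 y p.1 p.2 (ind q))) => -[a b] q.
rewrite /kcomp (sum_LG_R _ _ _ _ _ (fun c d => LG_row_inv s0 s1 y c d (ind q))).
by rewrite LG_rowK.
Qed.

Section YangBaxter.
Variables (om t : K) (n : nat).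
Hypotheses (om2 : om ^+ 2 = om - 1) (t0 : t != 0).

Lemma ADO_row_YB a b c (phi : nat -> nat -> nat -> K) :
  (a < 3)%N -> (b < 3)%N -> (c < 3)%N ->
  ADO_row om t a b (fun a1 b1 => ADO_row om t b1 c (fun b2 c2 =>
    ADO_row om t a1 b2 (fun a3 b3 => phi a3 b3 c2))) =
  ADO_row om t b c (fun b1 c1 => ADO_row om t a b1 (fun a2 b2 =>
    ADO_row om t b2 c1 (fun b3 c3 => phi a2 b3 c3))).
Proof.
move=> la lb lc.
do 3?[case: a la => [|a] la //]; do 3?[case: b lb => [|b] lb //];
do 3?[case: c lc => [|c] lc //]; rewrite /=; field: om2; rewrite ?t0 //.
Qed.

End YangBaxter.

End Units.

(** * Half twist *)

Section HalfTwist.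
Variables (S : pzRingType) (g : nat -> S) (n : nat).
Hypothesis g_braid : forall i, (i.+1 < n)%N -> g i * g i.+1 * g i = g i.+1 * g i * g i.+1.
Hypothesis g_far : forall i j, (i.+1 < j)%N -> (j < n)%N -> g i * g j = g j * g i.

Fixpoint up_prod k : S := if k is k'.+1 then up_prod k' * g k' else 1.
Fixpoint down_prod k : S := if k is k'.+1 then g k' * down_prod k' else 1.
Fixpoint half_twist k : S := if k is k'.+1 then up_prod k'.+1 * half_twist k' else 1.

Lemma up_far k j : (k < j)%N -> (j < n)%N -> up_prod k * g j = g j * up_prod k.
Proof.
elim: k => [|k IH] kj jn /=; first by rewrite mul1r mulr1.
by rewrite -mulrA g_far // mulrA IH ?mulrA // ltnW.
Qed.

Lemma down_far k j : (k < j)%N -> (j < n)%N -> down_prod k * g j = g j * down_prod k.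
Proof.
elim: k => [|k IH] kj jn /=; first by rewrite mul1r mulr1.
by rewrite -mulrA IH ?(ltnW kj) // mulrA g_far ?mulrA.
Qed.

Lemma half_twist_far k j : (k < j)%N -> (j < n)%N -> half_twist k * g j = g j * half_twist k.
Proof.
elim: k => [|k IH] kj jn; first by rewrite mul1r mulr1.
by rewrite [half_twist _]/(up_prod k.+1 * half_twist k) -mulrA IH ?(ltnW kj) // mulrA up_far ?mulrA.
Qed.

Lemma up_shift k i : (i.+1 < k)%N -> (k <= n)%N -> up_prod k * g i = g i.+1 * up_prod k.
Proof.
elim: k => [//|k IH]; rewrite ltnS leq_eqVlt => /orP [/eqP <-|ik] kn.
  have -> : up_prod i.+2 = up_prod i * g i * g i.+1 by [].
  by rewrite -!mulrA (mulrA (g i)) g_braid // !mulrA up_far.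
by rewrite /= -mulrA -g_far // mulrA IH ?mulrA // ltnW.
Qed.

Lemma down_shift k i : (i.+1 < k)%N -> (k <= n)%N -> down_prod k * g i.+1 = g i * down_prod k.
Proof.
elim: k => [//|k IH]; rewrite ltnS leq_eqVlt => /orP [/eqP <-|ik] kn.
  have -> : down_prod i.+2 = g i.+1 * (g i * down_prod i) by [].
  by rewrite -!mulrA down_far // !mulrA g_braid.
by rewrite /= -mulrA IH ?(ltnW kn) // mulrA -g_far ?mulrA.
Qed.

(** The second factorisation of the half twist. It serves in [half_twist_conj] for the top
    generator, which the recursive factorisation cannot move. *)
Lemma half_twist_down k : (k < n)%N -> half_twist k.+1 = half_twist k * down_prod k.+1.
Proof.
elim: k => [|k IH] kn; first by rewrite /= !(mulr1, mul1r).
have -> : half_twist k.+2 = up_prod k.+1 * g k.+1 * half_twist k.+1 by [].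
rewrite {1}IH ?(ltnW kn) // -[RHS]/(up_prod k.+1 * half_twist k * (g k.+1 * down_prod k.+1)).
by rewrite !mulrA -(mulrA _ (g k.+1)) -half_twist_far ?mulrA.
Qed.

Lemma half_twist_conj k i : (i < k)%N -> (k <= n)%N ->
  half_twist k * g i = g (k.-1 - i)%N * half_twist k.
Proof.
elim: k i => [//|k IH] i; rewrite ltnS leq_eqVlt => /orP [/eqP ->|ik] kn.
  case: k IH kn => [|k] IH kn; first by rewrite /= !(mulr1, mul1r).
  rewrite half_twist_down // -mulrA down_shift // mulrA IH ?(ltnW kn) //.
  by rewrite -!pred_Sn !subnn mulrA.
rewrite -[half_twist _]/(up_prod k.+1 * half_twist k) -mulrA IH ?(ltnW kn) // mulrA.
rewrite up_shift //; last by lia.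
by rewrite mulrA; congr (g _ * _ * _); lia.
Qed.

End HalfTwist.

Lemma rho_letter_far (K : fieldType) (m n : nat)
    (R' : 'I_m.+1 -> 'I_m.+1 -> 'I_m.+1 -> 'I_m.+1 -> K) i j :
  (i.+1 < j)%N -> (j.+1 < n)%N ->
  rho_letter R' n (i, true) *m rho_letter R' n (j, true) =
  rho_letter R' n (j, true) *m rho_letter R' n (i, true).
Proof.
move=> ij jn; have hi : (i.+1 < n)%N by lia.
apply: entry_inj => s z vs vz.
have E (k l : nat) : all (fun i => i.+1 < n)%N [:: k; l] ->
  entry (rho_letter R' n (k, true) *m rho_letter R' n (l, true)) s z
  = lop (Rpair R') k (lop (Rpair R') l (delta K z)) s.
  move=> /= w; rewrite -[RHS]/(ev R' [:: (k, true); (l, true)] (delta K z) s).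
  by rewrite -(entry_rho R' (n := n)) //= mulmx1.
rewrite !E /= ?hi ?jn //.
have [s1 [a [b [s2 [es sz la lb]]]]] := valid_split vs hi.
have vs2 : valid m.+1 (n - i.+2) s2.
  by move: vs; rewrite es /valid size_cat all_cat /= => /andP [/eqP <- /and4P [_ _ _ ->]];
     rewrite andbT; apply/eqP; lia.
have [|u1 [c [d [u2 [eu szu lc ld]]]]] := valid_split (k := (j - i.+2)%N) vs2; first by lia.
rewrite es eu -sz.
have Lj psi x y w v : lop (Rpair R') j psi (s1 ++ x :: y :: u1 ++ w :: v :: u2) =
    \sum_p Rpair R' (inord w, inord v) p *
      psi (s1 ++ x :: y :: u1 ++ val p.1 :: val p.2 :: u2).
  have e c' d' : s1 ++ x :: y :: u1 ++ c' :: d' :: u2 = (s1 ++ x :: y :: u1) ++ c' :: d' :: u2.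
    by rewrite -catA.
  have -> : j = size (s1 ++ x :: y :: u1) by rewrite size_cat /= szu sz; lia.
  by rewrite e lopE; apply: eq_bigr => p _; rewrite e.
rewrite lopE Lj; under eq_bigr => p _ do rewrite Lj mulr_sumr.
rewrite exchange_big; apply: eq_bigr => q _; rewrite lopE mulr_sumr.
by apply: eq_bigr => p _; rewrite mulrCA.
Qed.

Definition up_word k : braid_word := [seq (i, true) | i <- iota 0 k].
Fixpoint twist_word k : braid_word :=
  if k is k'.+1 then up_word k'.+1 ++ twist_word k' else [::].
Definition rev_word n (w : braid_word) : braid_word := [seq ((n.-2 - l.1)%N, l.2) | l <- w].

Lemma wf_twist_word n k : (k < n)%N -> wf_braid n (twist_word k).
Proof.
elim: k => [//|k IH] kn; rewrite -[twist_word _]/(up_word k.+1 ++ twist_word k).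
rewrite /wf_braid all_cat [X in _ && X]IH ?(ltnW kn) // andbT.
by apply/allP => l /mapP [i]; rewrite mem_iota => hi ->; rewrite /=; lia.
Qed.

Lemma wf_rev_word n w : wf_braid n w -> wf_braid n (rev_word n w).
Proof.
move=> /allP hw; apply/allP => _ /mapP [l /hw hl ->]; rewrite /=; lia.
Qed.

Section Twist.
Variables (K : fieldType) (om t : K) (n : nat).
Hypotheses (om0 : om != 0) (om2 : om ^+ 2 = om - 1) (t0 : t != 0).
Local Notation R := (ADO_R om t).
Local Notation L := (lop (Rpair R)).

Lemma eq_ADO_row a b phi psi :
  (forall c d, (c < 3)%N -> (d < 3)%N -> phi c d = psi c d) ->
  ADO_row om t a b phi = ADO_row om t a b psi.
Proof. by move=> e; case: a b => [|[|[|?]]] [|[|[|?]]] //=; rewrite !e. Qed.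

Lemma ADO_braid k : (k.+2 < n)%N ->
  rho_letter R n (k, true) *m rho_letter R n (k.+1, true) *m rho_letter R n (k, true) =
  rho_letter R n (k.+1, true) *m rho_letter R n (k, true) *m rho_letter R n (k.+1, true).
Proof.
move=> hk; have hk1 := ltnW hk; apply: entry_inj => s z vs vz.
have E (i j l : nat) : all (fun i => i.+1 < n)%N [:: i; j; l] ->
  entry (rho_letter R n (i, true) *m rho_letter R n (j, true) *m rho_letter R n (l, true)) s z
  = L i (L j (L l (delta K z))) s.
  move=> /= w; rewrite -[RHS]/(ev R [:: (i, true); (j, true); (l, true)] (delta K z) s).
  by rewrite -(entry_rho R (n := n)) //= mulmx1 mulmxA.
rewrite !E /= ?hk ?hk1 //.
have [s1 [a [b [s2 [es sz la lb]]]]] := valid_split vs hk1.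
have [c [s3 es2]] : exists c s3, s2 = c :: s3.
  case: s2 es => [|c s3] es; last by exists c, s3.
  by move: vs; rewrite es /valid size_cat /= => /andP [/eqP]; lia.
have lc : (c < 3)%N.
  by move: vs; rewrite es es2 /valid all_cat /= => /andP [_ /andP [_ /and4P []]].
rewrite es es2 -sz; set phi := delta K z.
have L0 psi x y u : (x < 3)%N -> (y < 3)%N ->
  L (size s1) psi (s1 ++ x :: y :: u) = ADO_row om t x y (fun c d => psi (s1 ++ c :: d :: u)).
  exact: lop_ADO.
have L1 psi w x y u : (x < 3)%N -> (y < 3)%N ->
  L (size s1).+1 psi (s1 ++ w :: x :: y :: u) =
  ADO_row om t x y (fun c d => psi (s1 ++ w :: c :: d :: u)).
  move=> lx ly; rewrite -cat_rcons -(size_rcons s1 w) lop_ADO //.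
  by apply: eq_ADO_row => c' d' _ _; rewrite cat_rcons.
have LHSE : L (size s1) (L (size s1).+1 (L (size s1) phi)) (s1 ++ [:: a, b, c & s3]) =
  ADO_row om t a b (fun a1 b1 => ADO_row om t b1 c (fun b2 c2 =>
    ADO_row om t a1 b2 (fun a3 b3 => phi (s1 ++ [:: a3, b3, c2 & s3])))).
  rewrite L0 //; apply: eq_ADO_row => a1 b1 *; rewrite L1 //.
  by apply: eq_ADO_row => b2 c2 *; rewrite L0.
rewrite LHSE (ADO_row_YB om2 t0 (fun a b c => phi (s1 ++ [:: a, b, c & s3]))) // L1 //.
apply: eq_ADO_row => a1 b1 *; rewrite L0 //.
by apply: eq_ADO_row => b2 c2 *; rewrite L1.
Qed.

Lemma rho_twist_word k :
  rho R n (twist_word k) = half_twist (fun i => rho_letter R n (i, true)) k.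
Proof.
elim: k => [//|k IH]; rewrite -[twist_word _]/(up_word k.+1 ++ twist_word k) rho_cat IH.
rewrite -[RHS]/(up_prod _ k.+1 *m _); congr (_ *m _).
elim: k.+1 {IH} => [//|j IH]; have -> : up_word j.+1 = up_word j ++ [:: (j, true)].
  by rewrite /up_word -(addn1 j) iotaD map_cat.
by rewrite rho_cat IH /= mulmx1.
Qed.

Lemma twist_rev w : wf_braid n w ->
  rho R n (twist_word n.-1) *m rho R n w = rho R n (rev_word n w) *m rho R n (twist_word n.-1).
Proof.
elim: w => [|[k b] w IH] /=; first by rewrite mulmx1 mul1mx.
case/andP=> /= hk /IH e; rewrite mulmxA.
have hk' : ((n.-2 - k).+1 < n)%N by lia.
suff -> : rho R n (twist_word n.-1) *m rho_letter R n (k, b) =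
          rho_letter R n ((n.-2 - k)%N, b) *m rho R n (twist_word n.-1).
  by rewrite -!mulmxA e.
have Et : rho R n (twist_word n.-1) *m rho_letter R n (k, true) =
          rho_letter R n ((n.-2 - k)%N, true) *m rho R n (twist_word n.-1).
  rewrite rho_twist_word.
  have := @half_twist_conj _ (fun i => rho_letter R n (i, true)) n.-1 _ _ n.-1 k.
  apply=> //; [|by move=> i j ij jn; apply: rho_letter_far; lia|by lia].
  by move=> i hi; apply: ADO_braid; lia.
case: b => //.
(* A negative letter follows from the positive case by cancelling on both sides. *)
have U := ADO_unit om0 t0.
rewrite -[LHS]mul1mx -(rho_letterK U false hk') /= -!mulmxA; congr (_ *m _).
by rewrite mulmxA -Et -!mulmxA (rho_letterK U true hk) mulmx1.
Qed.

End Twist.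

(** * Quantum group symmetry of the ADO R-matrix *)

Lemma lincomb (K : fieldType) (c l r x v : K) : l = r -> x - v = c * (l - r) -> x = v.
Proof. by move=> -> /eqP; rewrite subrr mulr0 subr_eq0 => /eqP. Qed.

Section Symmetry.
Variables (K : fieldType) (om t : K).
Local Notation R := (ADO_R om t).

Definition cartan (a : nat) : K := t * (- om) ^+ a.
Definition cartan_prod (s : seq nat) : K := \prod_(a <- s) cartan a.

(** With E, F, K the matrices of [raising], [lowering], [cartan], one has [F E + om E F = K^2 - 1]:
    a form of quantum sl2 at a sixth root of unity, on a three-dimensional module whose highest
    weight is generic. *)
Definition raising (a b : nat) : K :=
  match a, b with 1, 0 => 1 | 2, 1 => - om | _, _ => 0 end.
Definition lowering (a b : nat) : K :=
  match a, b with 0, 1 => t ^+ 2 - 1 | 1, 2 => - om * (1 + om * t ^+ 2) | _, _ => 0 end.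

(* The sum over the strands of [M] at that strand and [cartan] at the preceding ones. *)
Fixpoint coprod (M : nat -> nat -> K) (phi : seq nat -> K) (s : seq nat) : K :=
  if s is a :: s' then
    \sum_(b < 3) M a b * phi (val b :: s') + cartan a * coprod M (fun u => phi (a :: u)) s'
  else 0.

Lemma eq_coprod M n phi psi s : (forall s, valid 3 n s -> phi s = psi s) ->
  valid 3 n s -> coprod M phi s = coprod M psi s.
Proof.
elim: s n phi psi => [|a s IH] [|n] phi psi e vs //=.
move: vs; rewrite valid_cons => /andP [la vs]; congr (_ + _ * _).
  by apply: eq_bigr => b _; rewrite e // valid_cons ltn_ord.
by apply: IH vs => u vu; apply: e; rewrite valid_cons la.
Qed.

Lemma coprod_ext M phi psi s : phi =1 psi -> coprod M phi s = coprod M psi s.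
Proof.
elim: s phi psi => [|a s IH] phi psi e //=.
by rewrite (IH _ (fun u => psi (a :: u))) //; under eq_bigr => b _ do rewrite e.
Qed.

Lemma coprod_sum M (J : finType) (c : J -> K) (phi : J -> seq nat -> K) s :
  coprod M (fun s => \sum_j c j * phi j s) s = \sum_j c j * coprod M (phi j) s.
Proof.
elim: s phi => [|a s IH] phi /=; first by rewrite big1 // => j _; rewrite mulr0.
rewrite IH mulr_sumr.
under [in RHS]eq_bigr => j _ do rewrite mulrDr.
rewrite big_split /=; congr (_ + _); last by apply: eq_bigr => j _; rewrite mulrCA.
under eq_bigr => b _ do rewrite mulr_sumr.
rewrite exchange_big; apply: eq_bigr => j _ /=; rewrite mulr_sumr.
by apply: eq_bigr => b _; rewrite mulrCA.
Qed.

Lemma coprod_row M a b (Phi : nat -> nat -> seq nat -> K) s :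
  coprod M (fun u => ADO_row om t a b (fun c d => Phi c d u)) s =
  ADO_row om t a b (fun c d => coprod M (Phi c d) s).
Proof.
elim: s Phi => [|x s IH] Phi /=.
  by case: a b => [|[|[|?]]] [|[|[|?]]] //=; ring.
rewrite IH {IH}.
rewrite !big_ord_recl !big_ord0 /= /bump /=.
by case: a b => [|[|[|?]]] [|[|[|?]]] /=; rewrite ?big_ord_recl ?big_ord0 /= /bump /=; ring.
Qed.

Lemma coprod_cat M phi s1 s2 : coprod M phi (s1 ++ s2) =
  coprod M (fun u => phi (u ++ s2)) s1 + cartan_prod s1 * coprod M (fun u => phi (s1 ++ u)) s2.
Proof.
elim: s1 phi => [|a s1 IH] phi /=; first by rewrite /cartan_prod big_nil add0r mul1r.
by rewrite IH /cartan_prod big_cons; ring.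
Qed.

Lemma coprod_rcons M phi s a : coprod M phi (rcons s a) =
  coprod M (fun u => phi (rcons u a)) s +
  cartan_prod s * \sum_(b < 3) M a b * phi (rcons s (val b)).
Proof.
rewrite -cats1 coprod_cat /= mulr0 addr0.
have e u b : phi (u ++ [:: b]) = phi (rcons u b) by rewrite cats1.
congr (_ + _ * _); last by apply: eq_bigr => b _; rewrite e.
exact: coprod_ext.
Qed.

Hypotheses (om2 : om ^+ 2 = om - 1) (t0 : t != 0).

(** [X] and [Y] stand for the terms of the coproduct acting to the left and to the right of the two
    strands, and [q] for the Cartan factor of the left context. The identity says that R commutes
    with the two-strand coproduct of [M] and with the tensor square of [cartan]. *)
Lemma coprod_row_comm M a b q (phi X Y : nat -> nat -> K) :
  (M = raising) \/ (M = lowering) -> (a < 3)%N -> (b < 3)%N ->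
  let row := ADO_row om t in
  row a b X + q * (\sum_(c < 3) M a c * row c b phi +
    cartan a * (\sum_(c < 3) M b c * row a c phi + cartan b * row a b Y)) =
  row a b (fun c d => X c d + q * (\sum_(e < 3) M c e * phi e d +
    cartan c * (\sum_(e < 3) M d e * phi c e + cartan d * Y c d))).
Proof.
move=> [] -> la lb /=; rewrite !big_ord_recl !big_ord0 /= /bump /=;
do 3?[case: a la => [|a] la //]; do 3?[case: b lb => [|b] lb //]; rewrite /= /cartan;
rewrite ?big_ord_recl ?big_ord0 /= /bump /=; field: om2; rewrite ?t0 //.
Qed.

Lemma coprod_lop M n k phi s : (M = raising) \/ (M = lowering) ->
  (k.+1 < n)%N -> valid 3 n s ->
  coprod M (lop (Rpair R) k phi) s = lop (Rpair R) k (coprod M phi) s.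
Proof.
move=> hM hk vs; have [s1 [a [b [s2 [es sz la lb]]]]] := valid_split vs hk.
rewrite es -sz lop_ADO // coprod_cat /=.
have v1 : valid 3 (size s1) s1.
  by move: vs; rewrite es /valid all_cat eqxx => /andP [_ /andP [->]].
rewrite (@eq_coprod M (size s1) _
  (fun u => ADO_row om t a b (fun c d => phi (u ++ c :: d :: s2)))) //; last first.
  by move=> u /andP [/eqP <- _]; rewrite lop_ADO.
rewrite coprod_row.
rewrite (coprod_ext M (psi := fun u => ADO_row om t a b (fun c d => phi (s1 ++ c :: d :: u))));
  last by move=> u; rewrite lop_ADO.
rewrite coprod_row.
under eq_bigr => c _ do rewrite lop_ADO //.
under [\sum_(c < 3) M b c * _]eq_bigr => c _ do rewrite lop_ADO //.
rewrite (coprod_row_comm _ (fun c d => phi (s1 ++ c :: d :: s2))) //.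
by case: a b la lb {es} => [|[|[|?]]] [|[|[|?]]] // _ _; rewrite /= !coprod_cat.
Qed.

Definition charged n (A : seq nat -> seq nat -> K) : Prop :=
  forall x y, valid 3 n x -> valid 3 n y -> A x y != 0 -> sumn x = sumn y.

(** On the column index the operator acts through its transpose; [cartan] is diagonal, so only [M]
    has to be transposed. *)
Definition intertwines M n (A : seq nat -> seq nat -> K) : Prop :=
  forall x y, valid 3 n x -> valid 3 n y ->
    coprod M (A^~ y) x = coprod (fun a b => M b a) (A x) y.

Definition invariant_kernel n A : Prop :=
  [/\ charged n A, intertwines raising n A & intertwines lowering n A].

Lemma coprod_delta M n x y : valid 3 n x -> valid 3 n y ->
  coprod M (delta K y) x = coprod (fun a b => M b a) (fun z => delta K z x) y.
Proof.
elim: n x y => [|n IH] [|a x] [|c y] //; rewrite !valid_cons => /andP [la vx] /andP [lc vy] /=.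
congr (_ + _).
  have pick (G : nat -> K) d (q : bool) : (d < 3)%N ->
      \sum_(b < 3) G b * ((val b == d) && q)%:R = G d * q%:R.
    move=> ld; rewrite (bigD1 (Ordinal ld)) //= eqxx big1 ?addr0 // => b nb.
    have -> : (val b == d) = false by apply/negbTE; apply: contraNneq nb => e; apply/eqP/val_inj.
    by rewrite mulr0.
  rewrite /delta; under eq_bigr => b _ do rewrite eqseq_cons.
  under [in RHS]eq_bigr => b _ do rewrite eqseq_cons (eq_sym a).
  by rewrite pick // (pick (M^~ c)).
have [<-|ne] := eqVneq a c.
  rewrite (coprod_ext M (psi := delta K y)) ?IH //.
    by congr (_ * _); apply: coprod_ext => z; rewrite /delta eqseq_cons eqxx.
  by move=> u; rewrite /delta eqseq_cons eqxx.
have Z N (phi : seq nat -> K) s : phi =1 (fun=> 0) -> coprod N phi s = 0.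
  move=> e; elim: s phi e => [//|b s IHs] phi e /=; rewrite IHs // mulr0 addr0.
  by rewrite big1 // => d _; rewrite e mulr0.
by rewrite !Z ?mulr0 // => u; rewrite /delta eqseq_cons (negPf ne).
Qed.

Hypothesis R_unit : mxo (Rpair R) \in unitmx.

Lemma ev_intertwines M n w : (M = raising) \/ (M = lowering) -> wf_braid n w ->
  intertwines M n (fun x y => ev R w (delta K y) x).
Proof.
move=> hM; elim: w => [|[k b] w IH] /= hw x y vx vy.
  exact: coprod_delta vx vy.
case/andP: hw => /= hk hw.
rewrite (commutes_letter (n := n) (O := coprod M) (k := k) R_unit b hk) //; first last.
- by move=> phi s vs; apply: (coprod_lop _ hM hk).
- by move=> phi psi e s; apply: eq_coprod.
transitivity (lop (letter_kernel R b) k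
  (fun x' => coprod (fun a b => M b a) (fun y' => ev R w (delta K y') x') y) x).
  by apply: (eq_lop (n := n)) => // s vs; apply: IH.
by rewrite /lop -coprod_sum.
Qed.

Hypothesis natr_neq0 : forall k : nat, (k.+1%:R != 0 :> K).

Lemma natr_inj (i j : nat) : i%:R = j%:R :> K -> i = j.
Proof.
wlog ij : i j / (i <= j)%N => [H|] e.
  by case/orP: (leq_total i j) => h; [|apply/esym]; apply: H.
have := natr_neq0 (j - i).-1; have [->|ji] := eqVneq i j; first by [].
have -> : ((j - i).-1.+1 = j - i)%N by lia.
by rewrite natrB // e subrr eqxx.
Qed.

(** Multiplication by [sumn] commutes with R, hence with every letter. Comparing both sides on an
    entry gives [sumn x = sumn y] in K wherever the entry is nonzero, and characteristic zero lifts
    this to integers. *)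
Lemma ev_charged n w : wf_braid n w -> charged n (fun x y => ev R w (delta K y) x).
Proof.
move=> hw x y vx vy nz; apply: natr_inj; apply: (mulIf nz) => {nz}.
elim: w x hw vx => [|[k b] w IH] /= x hw vx.
  by rewrite /delta; case: eqP => [->|]; rewrite ?mulr0.
case/andP: hw => /= hk hw.
rewrite (commutes_letter (n := n) (O := fun phi s => (sumn s)%:R * phi s) R_unit b hk) //.
- rewrite -lop_scale; apply: (eq_lop (n := n)) => // s vs; exact: IH.
- by move=> phi psi e s vs; rewrite e.
move=> phi s vs; have [s1 [a [d [s2 [-> <- la ld]]]]] := valid_split vs hk.
rewrite !lop_ADO //.
by case: a d la ld => [|[|[|?]]] [|[|[|?]]] // _ _; rewrite /= !sumn_cat /=; ring.
Qed.

End Symmetry.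

(** * Partial closures and the two-strand case *)

Section Closing.
Variables (K : fieldType) (om t : K).
Hypotheses (om0 : om != 0) (om2 : om ^+ 2 = om - 1) (t0 : t != 0).
Implicit Types A : seq nat -> seq nat -> K.

Definition right_weight (a : nat) : K := om ^+ (2 * a) * t ^+ 2.
(** The inverse of [right_weight], because [om^3 = -1]. *)
Definition left_weight (a : nat) : K := (- om) ^+ a * t ^- 2.

Definition close_right A x y : K :=
  \sum_(a < 3) right_weight a * A (rcons x (val a)) (rcons y (val a)).
Definition close_left A x y : K :=
  \sum_(a < 3) left_weight a * A (val a :: x) (val a :: y).

Lemma cartan_prod_sumn n s : valid 3 n s -> cartan_prod om t s = t ^+ n * (- om) ^+ sumn s.
Proof.
elim: n s => [|n IH] [|a s] //; first by rewrite /cartan_prod big_nil /= mulr1.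
rewrite valid_cons => /andP [_ vs].
rewrite /cartan_prod big_cons -/(cartan_prod _ _ _) (IH s vs) /cartan /=.
by rewrite exprS exprD; ring.
Qed.

Lemma om_inv a : (- om) ^+ a * om ^+ (2 * a) = 1.
Proof.
rewrite exprM -exprMn.
have -> : - om * om ^+ 2 = 1 by rewrite om2; ring: om2.
exact: expr1n.
Qed.

Lemma charged_closeR n A : charged n.+1 A -> charged n (close_right A).
Proof.
move=> ch x y vx vy; apply: contraNeq => ne; rewrite /close_right big1 // => a _.
have [->|nz] := eqVneq (A (rcons x (val a)) (rcons y (val a))) 0; first by rewrite mulr0.
case/eqP: ne; have := ch _ _ _ _ nz; rewrite !valid_rcons !ltn_ord vx vy !sumn_rcons => e.
by move: (e isT isT) => /eqP; rewrite eqn_add2r => /eqP.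
Qed.

Lemma charged_closeL n A : charged n.+1 A -> charged n (close_left A).
Proof.
move=> ch x y vx vy; apply: contraNeq => ne; rewrite /close_left big1 // => a _.
have [->|nz] := eqVneq (A (val a :: x) (val a :: y)) 0; first by rewrite mulr0.
case/eqP: ne; have := ch _ _ _ _ nz; rewrite !valid_cons !ltn_ord vx vy /= => e.
by move: (e isT isT) => /eqP; rewrite eqn_add2l => /eqP.
Qed.

(* The right weights are inverse to [cartan] up to a scalar, so the terms of the coproduct
   acting on the closed strand cancel by conservation of charge. *)
Lemma intertwines_closeR M n A : charged n.+1 A ->
  intertwines om t M n.+1 A -> intertwines om t M n (close_right A).
Proof.
move=> ch int x y vx vy; rewrite /close_right.
rewrite (coprod_sum om t M (fun a : 'I_3 => right_weight a)
  (fun a u => A (rcons u (val a)) (rcons y (val a)))).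
rewrite (coprod_sum om t (fun a b => M b a) (fun a : 'I_3 => right_weight a)
  (fun a u => A (rcons x (val a)) (rcons u (val a)))).
pose Q := \sum_(a < 3) \sum_(b < 3)
  cartan_prod om t x * right_weight a * (M a b * A (rcons x (val b)) (rcons y (val a))).
apply: (addIr Q); rewrite {1}/Q -big_split /=.
have -> : Q = \sum_(a < 3) \sum_(b < 3)
    cartan_prod om t y * right_weight a * (M b a * A (rcons x (val a)) (rcons y (val b))).
  rewrite [RHS]exchange_big /=; apply: eq_bigr => a _; apply: eq_bigr => b _.
  set c := A _ _; have [->|nz] := eqVneq c 0; first by rewrite !mulr0.
  have := ch _ _ _ _ nz; rewrite !valid_rcons !ltn_ord vx vy !sumn_rcons => /(_ isT isT) e.
  rewrite (cartan_prod_sumn vx) (cartan_prod_sumn vy) /right_weight.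
  have {e} : (- om) ^+ (sumn x) * om ^+ (2 * a) = (- om) ^+ (sumn y) * om ^+ (2 * b).
    rewrite -[LHS]mulr1 -(om_inv b) -[RHS]mulr1 -(om_inv a).
    transitivity ((- om) ^+ (sumn x + b) * om ^+ (2 * a) * om ^+ (2 * b)).
      by rewrite exprD; ring.
    by rewrite e exprD; ring.
  by move=> e; transitivity (t ^+ n * t ^+ 2 * M a b * c * ((- om) ^+ sumn x * om ^+ (2 * a)));
     [ring|rewrite e; ring].
rewrite -big_split; apply: eq_bigr => a _ /=.
have := int (rcons x (val a)) (rcons y (val a)).
rewrite !valid_rcons !ltn_ord vx vy => /(_ isT isT); rewrite !coprod_rcons => e.
by rewrite -!mulr_sumr; apply: (lincomb (c := right_weight a) e); ring.
Qed.

(** The left weight is a multiple of [cartan], which the coproduct already puts on the first strand.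
    The terms where [M] acts on this strand are then unweighted, and they cancel by exchanging the
    two labels. *)
Lemma intertwines_closeL M n A :
  intertwines om t M n.+1 A -> intertwines om t M n (close_left A).
Proof.
move=> int x y vx vy; rewrite /close_left.
rewrite (coprod_sum om t M (fun a : 'I_3 => left_weight a)
  (fun a u => A (val a :: u) (val a :: y))).
rewrite (coprod_sum om t (fun a b => M b a) (fun a : 'I_3 => left_weight a)
  (fun a u => A (val a :: x) (val a :: u))).
have wE a : left_weight a = t ^- 3 * cartan om t a by rewrite /left_weight /cartan; field.
under eq_bigr => a _ do rewrite wE -mulrA.
under [in RHS]eq_bigr => a _ do rewrite wE -mulrA.
rewrite -!mulr_sumr; congr (_ * _).
pose Q := \sum_(a < 3) \sum_(b < 3) M a b * A (val b :: x) (val a :: y).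
apply: (addrI Q); rewrite {1}/Q -big_split /= /Q exchange_big -big_split /=.
apply: eq_bigr => a _.
have := int (val a :: x) (val a :: y).
by rewrite !valid_cons !ltn_ord vx vy => /(_ isT isT).
Qed.

Lemma invariant_closeR n A :
  invariant_kernel om t n.+1 A -> invariant_kernel om t n (close_right A).
Proof.
by case=> ch iF iE; split; [exact: charged_closeR|apply: intertwines_closeR..].
Qed.

Lemma invariant_closeL n A :
  invariant_kernel om t n.+1 A -> invariant_kernel om t n (close_left A).
Proof.
by case=> ch iF iE; split; [exact: charged_closeL|apply: intertwines_closeL..].
Qed.

Hypothesis nz1 : t ^+ 2 - 1 != 0.
Hypothesis nz2 : 1 + om * t ^+ 2 != 0.

Local Ltac by_equation c H :=
  by apply: (lincomb (c := c) H); rewrite /= /cartan; field;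
     rewrite ?oppr_eq0 ?om0 ?t0 ?nz1 ?nz2.

Definition entry2 A (i j k l : nat) : K := A [:: i; j] [:: k; l].

(* Commutation with [raising] and [lowering] expresses all entries through those at
   00|00, 01|01 and 11|11. *)
Lemma invariant_two A a b : invariant_kernel om t 2 A -> (a < 3)%N -> (b < 3)%N ->
  close_right A [:: a] [:: a] = close_left A [:: b] [:: b].
Proof.
case=> _ iF iE la lb.
have sum3 (f : nat -> K) : \sum_(e < 3) f e = f 0%N + f 1%N + f 2%N.
  by rewrite !big_ord_recl big_ord0 /= addr0 addrA.
have eqM M : intertwines om t M 2 A -> forall i j k l, all (gtn 3) [:: i; j; k; l] ->
  M i 0%N * entry2 A 0 j k l + M i 1%N * entry2 A 1 j k l + M i 2%N * entry2 A 2 j k l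
  + cartan om t i *
    (M j 0%N * entry2 A i 0 k l + M j 1%N * entry2 A i 1 k l + M j 2%N * entry2 A i 2 k l) =
  M 0%N k * entry2 A i j 0 l + M 1%N k * entry2 A i j 1 l + M 2%N k * entry2 A i j 2 l
  + cartan om t k *
    (M 0%N l * entry2 A i j k 0 + M 1%N l * entry2 A i j k 1 + M 2%N l * entry2 A i j k 2).
  move=> h i j k l /= /and5P [li lj lk ll _].
  have := h [:: i; j] [:: k; l]; rewrite /valid /= li lj lk ll => /(_ isT isT).
  rewrite !mulr0 !addr0 (sum3 (fun e => M i e * entry2 A e j k l)).
  rewrite (sum3 (fun e => M j e * entry2 A i e k l)).
  by rewrite (sum3 (fun e => M e k * entry2 A i j e l)) (sum3 (fun e => M e l * entry2 A i j k e)).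
have F i j k l h := eqM _ iF i j k l h; have E i j k l h := eqM _ iE i j k l h.
(* The relations [F] come from [raising] and the relations [E] from [lowering]; each is solved for
   one new entry in terms of earlier ones. Apart from [om] and [t], the divisors are [t^2 - 1] and
   [1 + om t^2], which come from the entries of [lowering]. *)
have c0110 : entry2 A 0 1 1 0 = t * (entry2 A 0 0 0 0 - entry2 A 0 1 0 1).
  by_equation (-1 : K) (F 0 1 0 0 isT).
have c1001 : entry2 A 1 0 0 1 = t * (entry2 A 0 0 0 0 - entry2 A 0 1 0 1).
  by_equation ((t ^+ 2 - 1)^-1 : K) (E 0 0 0 1 isT).
have c1010 : entry2 A 1 0 1 0 = entry2 A 0 0 0 0 - t * entry2 A 1 0 0 1.
  by_equation (-1 : K) (F 1 0 0 0 isT).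
have c0211 : entry2 A 0 2 1 1 =
    (t ^+ 2 - 1) * (entry2 A 0 1 0 1 - om * t * entry2 A 0 1 1 0 - entry2 A 1 1 1 1)
     / (t * (- om * (1 + om * t ^+ 2))).
  by_equation ((t * (- om * (1 + om * t ^+ 2)))^-1 : K) (E 0 1 1 1 isT).
have c2011 : entry2 A 2 0 1 1 =
    (t ^+ 2 - 1) * (entry2 A 1 0 0 1 - om * t * entry2 A 1 0 1 0 + om * t * entry2 A 1 1 1 1)
     / (- om * (1 + om * t ^+ 2)).
  by_equation ((- om * (1 + om * t ^+ 2))^-1 : K) (E 1 0 1 1 isT).
have c0202 : entry2 A 0 2 0 2 = entry2 A 0 1 0 1 + entry2 A 0 2 1 1 / (om * t).
  by_equation ((om * t)^-1 : K) (F 0 2 0 1 isT).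
have c1102 : entry2 A 1 1 0 2 =
    (entry2 A 1 1 1 1 - entry2 A 0 1 0 1 + om * t * entry2 A 1 0 0 1) / (om * t).
  by_equation ((om * t)^-1 : K) (F 1 1 0 1 isT).
have c2002 : entry2 A 2 0 0 2 = (entry2 A 2 0 1 1 + om * entry2 A 1 0 0 1) / (om * t).
  by_equation ((om * t)^-1 : K) (F 2 0 0 1 isT).
have c1120 : entry2 A 1 1 2 0 =
    (om * t * entry2 A 1 0 1 0 - entry2 A 0 1 1 0) / om - t * entry2 A 1 1 1 1.
  by_equation (om^-1 : K) (F 1 1 1 0 isT).
have c2020 : entry2 A 2 0 2 0 = entry2 A 1 0 1 0 - t * entry2 A 2 0 1 1.
  by_equation (om^-1 : K) (F 2 0 1 0 isT).
have c1212 : entry2 A 1 2 1 2 = entry2 A 0 2 0 2 + om ^+ 2 * t * entry2 A 1 1 0 2.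
  by_equation (-1 : K) (F 1 2 0 2 isT).
have c2112 : entry2 A 2 1 1 2 = om ^+ 2 * t * entry2 A 2 0 0 2 - om * entry2 A 1 1 0 2.
  by_equation (-1 : K) (F 2 1 0 2 isT).
have c2121 : entry2 A 2 1 2 1 = entry2 A 2 0 2 0 - entry2 A 1 1 2 0 / (om * t).
  by_equation (- (om ^+ 2 * t)^-1 : K) (F 2 1 2 0 isT).
have c2222 : entry2 A 2 2 2 2 = entry2 A 1 2 1 2 + om ^+ 2 * t * entry2 A 2 1 1 2.
  by_equation (om^-1 : K) (F 2 2 1 2 isT).
rewrite /close_right /close_left (sum3 (fun e => right_weight e * entry2 A a e a e)).
rewrite (sum3 (fun e => left_weight e * entry2 A e b e b)) /right_weight /left_weight.
by do 3?[case: a la => [|a] la //]; do 3?[case: b lb => [|b] lb //];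
   rewrite ?c2222 ?c2121 ?c2112 ?c1212 ?c2020 ?c1120 ?c2002 ?c1102 ?c0202 ?c2011 ?c0211
     ?c1010 ?c1001 ?c0110;
   field: om2; rewrite ?oppr_eq0 ?om0 ?t0 ?nz1 ?nz2.
Qed.

End Closing.

(** * Opening at the first and at the last strand *)

Section Ambidextrous.
Variables (K : fieldType) (om t : K).
Hypotheses (om0 : om != 0) (om2 : om ^+ 2 = om - 1) (t0 : t != 0).
Hypothesis nz1 : t ^+ 2 - 1 != 0.
Hypothesis nz2 : 1 + om * t ^+ 2 != 0.
Hypothesis natr_neq0 : forall k : nat, (k.+1%:R != 0 :> K).
Local Notation R := (ADO_R om t).
Local Notation closeR := (close_right om t).
Local Notation closeL := (close_left om t).
Implicit Types A : seq nat -> seq nat -> K.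

Lemma iter_closeR n A x y : iter n closeR A x y =
  lsum 3 n (fun u => \prod_(a <- u) right_weight om t a * A (x ++ u) (y ++ u)).
Proof.
elim: n x y => [|n IH] x y /=; first by rewrite big_nil mul1r !cats0.
apply: eq_bigr => a _; rewrite IH -lsum_distr; apply: eq_lsum => u _.
by rewrite big_cons !cat_rcons mulrA.
Qed.

Lemma iter_closeL n A x y : iter n closeL A x y =
  lsum 3 n (fun u => \prod_(a <- u) left_weight om t a * A (u ++ x) (u ++ y)).
Proof.
elim: n x y => [|n IH] x y; first by rewrite /= big_nil mul1r.
rewrite lsum_rcons iterS; apply: eq_bigr => a _; rewrite IH -lsum_distr.
by apply: eq_lsum => u _; rewrite big_rcons !cat_rcons /= mulrA; congr (_ * _); rewrite mulrC.
Qed.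

Lemma iter_closeL_closeR n A x y :
  iter n closeL (closeR A) x y = closeR (iter n closeL A) x y.
Proof.
elim: n x y => [//|n IH] x y; rewrite iterS /close_left.
under eq_bigr => a _ do rewrite IH /close_right mulr_sumr.
rewrite exchange_big; apply: eq_bigr => b _ /=; rewrite mulr_sumr.
by apply: eq_bigr => a _; rewrite mulrCA.
Qed.

Lemma invariant_iter_closeL n k A :
  invariant_kernel om t (n + k) A -> invariant_kernel om t k (iter n closeL A).
Proof. by elim: n k => [//|n IH] k; rewrite addSnnS => /IH; exact: invariant_closeL. Qed.

(** Close the last strand on the right and move the other closures to the left by induction. Left
    and right closures commute, so the right one can be performed last, on a two-strand kernel. *)
Lemma close_all n A a b : invariant_kernel om t n.+2 A -> (a < 3)%N -> (b < 3)%N ->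
  iter n.+1 closeR A [:: a] [:: a] = iter n.+1 closeL A [:: b] [:: b].
Proof.
elim: n A => [|n IH] A inv la lb; first exact: invariant_two.
rewrite iterSr (IH _ _ la lb); last exact: invariant_closeR.
rewrite iter_closeL_closeR (iterS n.+1); apply: invariant_two => //.
by apply: invariant_iter_closeL; rewrite addn2.
Qed.

Definition first_open (s : seq nat) : K := \prod_(a <- behead s) right_weight om t a.
Definition last_open (s : seq nat) : K := \prod_(a <- behead (rev s)) left_weight om t a.

Lemma lsum_first_open n A : lsum 3 n.+1 (fun s => first_open s * A s s) =
  \sum_(a < 3) iter n closeR A [:: val a] [:: val a].
Proof. by apply: eq_bigr => a _; rewrite iter_closeR. Qed.

Lemma lsum_last_open n A : lsum 3 n.+1 (fun s => last_open s * A s s) =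
  \sum_(a < 3) iter n closeL A [:: val a] [:: val a].
Proof.
rewrite lsum_rcons; apply: eq_bigr => a _; rewrite iter_closeL; apply: eq_lsum => u _.
by rewrite /last_open rev_rcons cats1 /= (perm_big u) // perm_rev.
Qed.

Variable n : nat.

Let R_unit : mxo (Rpair R) \in unitmx := ADO_unit om0 t0.

Definition traceR w : K := \tr (@diagm K 2 n first_open *m rho R n w).
Definition traceL w : K := \tr (@diagm K 2 n last_open *m rho R n w).

Lemma trace_lsum f w : wf_braid n w ->
  \tr (@diagm K 2 n f *m rho R n w) =
  lsum 3 n (fun s => f s * ev R w (delta K s) s).
Proof.
move=> hw; rewrite mxtrace_diagm; apply: eq_lsum => s vs.
by rewrite entry_rho.
Qed.

Lemma ev_invariant w : wf_braid n w ->
  invariant_kernel om t n (fun x y => ev R w (delta K y) x).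
Proof.
move=> hw; split; first exact: ev_charged.
- by apply: ev_intertwines => //; left.
- by apply: ev_intertwines => //; right.
Qed.

Lemma traceRE w a : wf_braid n w -> (1 < n)%N -> (a < 3)%N ->
  traceR w = 3%:R * iter n.-1 closeL (fun x y => ev R w (delta K y) x) [:: a] [:: a].
Proof.
move=> hw n1 la; rewrite /traceR trace_lsum //.
have inv := ev_invariant hw; case: n n1 inv => [|[|n']] // _ inv.
rewrite (lsum_first_open n'.+1 (fun x y => ev R w (delta K y) x)).
rewrite (eq_bigr (fun=> iter n'.+1 closeL (fun x y => ev R w (delta K y) x) [:: a] [:: a])).
  by rewrite sumr_const card_ord mulr_natl.
by move=> b _; exact: close_all inv (ltn_ord b) la.
Qed.

Lemma traceLE w a : wf_braid n w -> (1 < n)%N -> (a < 3)%N ->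
  traceL w = 3%:R * iter n.-1 closeL (fun x y => ev R w (delta K y) x) [:: a] [:: a].
Proof.
move=> hw n1 la; rewrite /traceL trace_lsum //.
have inv := ev_invariant hw; case: n n1 inv => [|[|n']] // _ inv.
rewrite (lsum_last_open n'.+1 (fun x y => ev R w (delta K y) x)).
rewrite (eq_bigr (fun=> iter n'.+1 closeL (fun x y => ev R w (delta K y) x) [:: a] [:: a])).
  by rewrite sumr_const card_ord mulr_natl.
by move=> b _; rewrite -(close_all inv la (ltn_ord b)); exact: (close_all inv la la).
Qed.

Lemma traceRL w : wf_braid n w -> (1 < n)%N -> traceR w = traceL w.
Proof. by move=> hw n1; rewrite (traceRE (a := 0)) // (traceLE (a := 0)). Qed.

Lemma weight_comm f l : (l.1.+1 < n)%N ->
  (forall phi s, valid 3 n s -> f s * lop (Rpair R) l.1 phi s =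
     lop (Rpair R) l.1 (fun s' => f s' * phi s') s) ->
  @diagm K 2 n f *m rho_letter R n l = rho_letter R n l *m @diagm K 2 n f.
Proof.
move=> hl comm; apply: diagm_comm => // phi s vs.
apply: (commutes_letter (O := fun phi s => f s * phi s) R_unit l.2 hl _ comm) => //.
by move=> phi1 phi2 e s' vs'; rewrite e.
Qed.

Lemma first_open_comm l : (0 < l.1)%N -> (l.1.+1 < n)%N ->
  @diagm K 2 n first_open *m rho_letter R n l = rho_letter R n l *m @diagm K 2 n first_open.
Proof.
move=> l0 hl; apply: weight_comm => // phi s vs.
have [s1 [a [d [s2 [-> sz la ld]]]]] := valid_split vs hl.
case: s1 sz => [|x s1] sz; first by rewrite -sz in l0.
rewrite -sz !lop_ADO // /first_open.
by case: a d la ld => [|[|[|?]]] [|[|[|?]]] // _ _;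
   rewrite /= !big_cat !big_cons /= /right_weight; ring.
Qed.

Lemma last_open_comm l : (l.1.+2 < n)%N ->
  @diagm K 2 n last_open *m rho_letter R n l = rho_letter R n l *m @diagm K 2 n last_open.
Proof.
move=> hl; apply: weight_comm => [|phi s vs]; first exact: ltnW.
have [s1 [a [d [s2 [es sz la ld]]]]] := valid_split vs (ltnW hl).
have [u [x eu]] : exists u x, s2 = rcons u x.
  case/lastP: s2 es => [es|u x _]; last by exists u, x.
  by case/andP: vs => /eqP; rewrite es size_cat sz /=; lia.
rewrite es eu -sz !lop_ADO // /last_open.
by case: a d la ld {es} => [|[|[|?]]] [|[|[|?]]] // _ _;
   rewrite /= ?rev_cat ?rev_cons ?rev_rcons /= -?cats1 ?big_cat /= ?big_seq1 /left_weight; ring.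
Qed.

(** A letter away from the first strand commutes with [first_open]. The remaining letter acts on the
    first two strands and misses the last one since [2 < n], so it commutes with [last_open], and
    [traceRL] passes between the two traces. *)
Lemma trace_cyclic1 l w : (2 < n)%N -> wf_braid n (l :: w) ->
  traceR (l :: w) = traceR (rcons w l).
Proof.
move=> n2 hw; have n1 := ltnW n2; have hw' : wf_braid n (rcons w l).
  by rewrite /wf_braid all_rcons.
have cyc f : @diagm K 2 n f *m rho_letter R n l = rho_letter R n l *m @diagm K 2 n f ->
  \tr (@diagm K 2 n f *m rho R n (l :: w)) =
  \tr (@diagm K 2 n f *m rho R n (rcons w l)).
  move=> e; rewrite -cats1 rho_cat /= mulmx1 mulmxA e -mulmxA mxtrace_mulC.
  by rewrite mulmxA.
case/andP: (hw) => hl _; have [l0|l0] := posnP l.1; last first.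
  by apply: cyc; apply: first_open_comm.
by rewrite !traceRL //; apply: cyc; apply: last_open_comm; rewrite l0.
Qed.

Lemma trace_cyclic u v : (2 < n)%N -> wf_braid n u -> wf_braid n v ->
  traceR (u ++ v) = traceR (v ++ u).
Proof.
move=> n2; elim: u v => [|l u IH] v; first by rewrite cats0.
case/andP=> hl hu hv; rewrite cat_cons trace_cyclic1 //; last first.
  by rewrite /wf_braid /= all_cat hl [all _ u]hu.
rewrite rcons_cat IH //; last by rewrite /wf_braid all_rcons hl.
by rewrite cat_rcons.
Qed.

Lemma trace_rev w : (1 < n)%N -> wf_braid n w -> traceR (rev_word n w) = traceR w.
Proof.
move=> n1 hw; have [n2|n2] := ltnP 2 n; last first.
  (* On two strands the only generator has index 0, and reversal fixes the word. *)
  have en : n = 2 by apply/eqP; rewrite eqn_leq n2 n1.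
  congr traceR; move: hw; rewrite en; elim: w => [//|[k b] w IH] /= /andP [hk /IH ->].
  by case: k hk.
pose tw := twist_word n.-1.
have htw : wf_braid n tw by apply: wf_twist_word; rewrite ltn_predL; apply: leq_trans n1.
have htw' : wf_braid n (inv_word tw) by rewrite wf_inv_word.
have e := rho_inv_word R_unit htw.
(* The half twist times its inverse is inserted on the right; then the half twist is moved across,
   which turns the reversed word back into [w], and cyclicity cancels the pair. *)
rewrite /traceR -[rho R n (rev_word n w)]mulmx1 -e [rho R n (rev_word n w) *m _]mulmxA.
rewrite -(twist_rev om0 om2 t0) // -!rho_cat -/(traceR _) -catA.
have hw2 : wf_braid n (w ++ inv_word tw) by rewrite /wf_braid all_cat [all _ w]hw.
by rewrite trace_cyclic // /traceR !rho_cat -mulmxA (mulmx1C e) mulmx1.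
Qed.

Lemma ADO_reversed w a : (0 < n)%N -> wf_braid n w -> (a < 3)%N ->
  lsum 3 n.-1 (fun u => \prod_(b <- u) left_weight om t b *
    ev R (rev_word n w) (delta K (rcons u a)) (rcons u a)) = ADO om t n w.
Proof.
move=> n0 hw la; have three : 3%:R != 0 :> K by exact: natr_neq0.
have adoE : ADO om t n w = 3%:R^-1 * traceR w.
  rewrite /ADO /braid_invariant (hop_diag (hd := right_weight om t)) //.
have [n1|n1] := ltnP 1 n; last first.
  have en : n = 1%N by apply/eqP; rewrite eqn_leq n1 n0.
  have ew : w = [::] by case: w hw {adoE} => [//|[k b] w]; rewrite en /= /wf_braid /=; lia.
  rewrite adoE ew /traceR trace_lsum // en /= big_nil mul1r /delta eqxx.
  rewrite (eq_bigr (fun=> 1)) ?sumr_const ?card_ord ?mulVf // => b _.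
  by rewrite /first_open /= big_nil mul1r /delta eqxx.
rewrite adoE -trace_rev // (traceRE (a := a)) ?wf_rev_word // mulKf // iter_closeL.
by apply: eq_lsum => u _; rewrite cats1.
Qed.

End Ambidextrous.

(** * Temperley-Lieb tensors *)

Section TemperleyLieb.
Variables (K : fieldType) (om s eta : K).
Hypotheses (s2 : s ^+ 2 = om - 1) (eta2 : eta ^+ 2 = 1) (eta_om : eta * om = - s).
Implicit Types v : seq bool -> K.

Definition pairing (a b : bool) : K :=
  match a, b with false, true => s | true, false => -1 | _, _ => 0 end.

Definition cup p v (l : seq bool) : K :=
  pairing (nth false l p) (nth false l p.+1) * v (take p l ++ drop p.+2 l).

(** Normalised so that the loop is [s^2 + 1 = om] and both zigzags are [- s]. *)
Definition cap p v (l : seq bool) : K :=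
  s * v (take p l ++ [:: false, true & drop p l]) - v (take p l ++ [:: true, false & drop p l]).

Lemma cupE v l1 a b l2 : cup (size l1) v (l1 ++ a :: b :: l2) = pairing a b * v (l1 ++ l2).
Proof.
rewrite /cup !nth_cat ltnn subnn ltnNge leqnSn /= subSnn /=.
rewrite take_size_cat // drop_cat ltnNge -addn2 leq_addr /= addKn /=.
by rewrite drop0.
Qed.

Lemma capE v l1 l2 : cap (size l1) v (l1 ++ l2) =
  s * v (l1 ++ [:: false, true & l2]) - v (l1 ++ [:: true, false & l2]).
Proof. by rewrite /cap take_size_cat // drop_size_cat. Qed.

(* [TL k v c]: the tensor [v] in the [k]-th tensor power of the doublet is a combination
   of cup diagrams, and [c] is its image under the one-dimensional functor sending
   the cup at position [p] to [eta ^+ p] and the cap at position [p] to [eta ^+ p * om]. *)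
Inductive TL : nat -> (seq bool -> K) -> K -> Prop :=
| TL_unit : TL 0 (fun=> 1) 1
| TL_zero k : TL k (fun=> 0) 0
| TL_cup k p v c : (p <= k)%N -> TL k v c -> TL k.+2 (cup p v) (eta ^+ p * c)
| TL_lin k a v c v' c' : TL k v c -> TL k v' c' ->
    TL k (fun l => a * v l + v' l) (a * c + c')
| TL_ext k v v' c c' : TL k v c -> (forall l, size l = k -> v l = v' l) -> c = c' ->
    TL k v' c'.

Lemma TL_scale k a v c : TL k v c -> TL k (fun l => a * v l) (a * c).
Proof.
move=> h; apply: (TL_ext (TL_lin (a - 1) h h)) => [l _|]; ring.
Qed.

Lemma split_size (T : Type) (l : seq T) p q : size l = (p + q)%N ->
  exists l1 l2, [/\ l = l1 ++ l2, size l1 = p & size l2 = q].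
Proof.
move=> e; exists (take p l), (drop p l).
by rewrite cat_take_drop size_takel ?size_drop e ?leq_addr ?addKn.
Qed.

Lemma cap_cup v l1 l2 : cap (size l1) (cup (size l1) v) (l1 ++ l2) = om * v (l1 ++ l2).
Proof. by rewrite capE !cupE /=; ring: s2. Qed.

Lemma cap_cup_succ v l1 x l2 :
  cap (size l1).+1 (cup (size l1) v) (l1 ++ x :: l2) = - s * v (l1 ++ x :: l2).
Proof.
rewrite -cat_rcons -(size_rcons l1 x) capE !cat_rcons !cupE.
by case: x => /=; ring.
Qed.

Lemma cap_succ_cup v l1 x l2 :
  cap (size l1) (cup (size l1).+1 v) (l1 ++ x :: l2) = - s * v (l1 ++ x :: l2).
Proof.
have e a b c u : cup (size l1).+1 v (l1 ++ [:: a, b, c & u]) = pairing b c * v (l1 ++ a :: u).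
  by rewrite -cat_rcons -(size_rcons l1 a) cupE cat_rcons.
by rewrite capE !e; case: x => /=; ring.
Qed.

Lemma cap_cup_far v l1 x y l2 l3 :
  cap (size l1 + size l2).+2 (cup (size l1) v) (l1 ++ [:: x, y & l2 ++ l3]) =
  cup (size l1) (cap (size l1 + size l2) v) (l1 ++ [:: x, y & l2 ++ l3]).
Proof.
have e1 (u : seq bool) : l1 ++ [:: x, y & l2 ++ u] = (l1 ++ [:: x, y & l2]) ++ u.
  by rewrite -catA.
have -> : (size l1 + size l2).+2 = size (l1 ++ [:: x, y & l2]) by rewrite size_cat /= !addnS.
rewrite cupE -size_cat catA capE -!catA e1 capE -!e1 !cupE; ring.
Qed.

Lemma cap_far_cup v l1 x y l2 l3 :
  cap (size l1) (cup (size l1 + size l2).+2 v) (l1 ++ l2 ++ [:: x, y & l3]) =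
  cup (size l1 + size l2) (cap (size l1) v) (l1 ++ l2 ++ [:: x, y & l3]).
Proof.
have e a b : cup (size l1 + size l2).+2 v (l1 ++ [:: a, b & l2 ++ [:: x, y & l3]]) =
  pairing x y * v (l1 ++ [:: a, b & l2 ++ l3]).
  have -> : (size l1 + size l2).+2 = size (l1 ++ [:: a, b & l2]) by rewrite size_cat /= !addnS.
  have e1 (u : seq bool) : l1 ++ [:: a, b & l2 ++ u] = (l1 ++ [:: a, b & l2]) ++ u.
    by rewrite -catA.
  by rewrite !e1 cupE.
by rewrite capE !e -size_cat catA cupE -catA capE; ring.
Qed.

(** Push the cap through the outermost cup: at the same position it forms a loop, at adjacent
    positions a zigzag, and otherwise the two commute. The values agree by [eta^2 = 1] for the loop
    and by [eta om = - s] for the zigzag. *)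
Lemma TL_cap_rec k v c : TL k v c -> forall k' p, k = k'.+2 -> (p <= k')%N ->
  TL k' (cap p v) (eta ^+ p * om * c).
Proof.
have etap p : eta ^+ p * eta ^+ p = 1 by rewrite -exprMn -expr2 eta2 expr1n.
(* Commuting a cap and a distant cup shifts one position by two, which the sign does not see. *)
have etaB p : (1 < p)%N -> eta ^+ (p - 2) = eta ^+ p.
  by move=> p1; rewrite -[in RHS](subnK p1) exprD eta2 mulr1.
elim=> {k v c} [|k|k q v c qk h IH|k a v c v' c' _ IH _ IH'|k v v' c c' _ IH e ec] // k' p ek pk.
- by apply: (TL_ext (TL_zero k')) => [l _|]; rewrite /cap ?mulr0 ?subr0.
- case: ek => ek; subst k'.
  have [pq|qp|pq] := ltngtP p q; last 1 first.
  + rewrite -pq {q pq qk}; apply: (TL_ext (TL_scale om h)) => [l sl|].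
      have [|l1 [l2 [-> <- _]]] := @split_size _ l p (k - p); first by lia.
      by rewrite cap_cup.
    by rewrite -[LHS]mul1r -(etap p); ring.
  + have [q1|q1] := eqVneq q p.+1.
      apply: (TL_ext (TL_scale (- s) h)) => [l sl|].
        have [|l1 [[|x l2] [-> z1 z2]]] := @split_size _ l p (k - p); first by lia.
          by move: z2 => /=; lia.
        by rewrite q1 -z1 cap_succ_cup.
      by rewrite q1 -eta_om exprS -[LHS]mul1r -(etap p); ring.
    have [k0 ek] : exists k0, k = k0.+2 by exists (k - 2)%N; lia.
    have pk0 : (p <= k0)%N by lia.
    have qk0 : (q - 2 <= k0)%N by lia.
    rewrite {1}ek; apply: (TL_ext (TL_cup qk0 (IH k0 p ek pk0))) => [l sl|].
      have [|l1 [l' [-> z1 z']]] := @split_size _ l p (k - p); first by lia.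
      have [|l2 [[|x [|y l3]] [-> z2]]] := @split_size _ l' (q - 2 - p) (k - q + 2);
        [by lia|by move=> /=; lia..|move=> _].
      have := cap_far_cup v l1 x y l2 l3; rewrite z1 z2.
      have -> : ((p + (q - 2 - p)).+2 = q)%N by lia.
      by have -> : (p + (q - 2 - p) = q - 2)%N by lia.
    by rewrite etaB; [ring|lia].
  have [q1|q1] := eqVneq p q.+1.
    apply: (TL_ext (TL_scale (- s) h)) => [l sl|].
      have [|l1 [[|x l2] [-> z1 z2]]] := @split_size _ l q (k - q); first by lia.
        by move: z2 => /=; lia.
      by rewrite q1 -z1 cap_cup_succ.
    by rewrite q1 -eta_om exprS -[LHS]mul1r -(etap q); ring.
  have [k0 ek] : exists k0, k = k0.+2 by exists (k - 2)%N; lia.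
  have pk0 : (p - 2 <= k0)%N by lia.
  have qk0 : (q <= k0)%N by lia.
  rewrite {1}ek; apply: (TL_ext (TL_cup qk0 (IH k0 _ ek pk0))) => [l sl|].
    have [|l1 [[|x [|y l']] [-> z1 z']]] := @split_size _ l q (k - q);
      [by lia|by move: z' => /=; lia..|].
    have [|l2 [l3 [-> z2 _]]] := @split_size _ l' (p - 2 - q) (k - p).
      by move: z' => /=; lia.
    have := cap_cup_far v l1 x y l2 l3; rewrite z1 z2.
    have -> : ((q + (p - 2 - q)).+2 = p)%N by lia.
    by have -> : (q + (p - 2 - q) = p - 2)%N by lia.
  by rewrite etaB; [ring|lia].
- apply: (TL_ext (TL_lin a (IH _ _ ek pk) (IH' _ _ ek pk))) => [l _|]; rewrite /cap; ring.
apply: (TL_ext (IH _ _ ek pk)) => [l sl|]; last by rewrite ec.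
by rewrite /cap !e // size_cat /= !addnS -size_cat cat_take_drop sl.
Qed.

Lemma TL_cap k p v c : TL k.+2 v c -> (p <= k)%N -> TL k (cap p v) (eta ^+ p * om * c).
Proof. by move=> h; apply: TL_cap_rec h _ _ _. Qed.

(** The empty diagram and the single cup are the only cup diagrams in these degrees, so the value
    determines the tensor. *)
Lemma TL_small k v c : TL k v c ->
  (k = 0%N -> v [::] = c) /\ (k = 2%N -> forall a b, v [:: a; b] = c * pairing a b).
Proof.
elim=> {k v c} [|k|k p v c pk _ [IH _]|k a v c v' c' _ [IH0 IH2] _ [IH0' IH2']
               |k v v' c c' _ [IH0 IH2] e ec].
- by split.
- by split=> // _ a b; rewrite mul0r.
- split=> // -[ek] a b; subst k; move: pk; rewrite leqn0 => /eqP ->.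
  by rewrite /cup /= IH // expr0 mul1r mulrC.
- by split=> [ek|ek a0 b]; rewrite ?IH0 ?IH0' ?IH2 ?IH2' // mulrDl mulrA.
- by split=> [ek|ek a b]; rewrite -e ?ek // -ec ?IH0 ?IH2.
Qed.

Fixpoint bsum m (f : seq bool -> K) : K :=
  if m is m'.+1 then bsum m' (fun u => f (false :: u)) + bsum m' (fun u => f (true :: u))
  else f [::].

Lemma eq_bsum m f g : (forall u, size u = m -> f u = g u) -> bsum m f = bsum m g.
Proof.
elim: m f g => [|m IH] f g e /=; first exact: e.
by congr (_ + _); apply: IH => u su; apply: e; rewrite /= su.
Qed.

Lemma bsumD m f g : bsum m (fun u => f u + g u) = bsum m f + bsum m g.
Proof. by elim: m f g => [//|m IH] f g /=; rewrite !IH addrACA. Qed.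

Lemma bsumZ m a f : bsum m (fun u => a * f u) = a * bsum m f.
Proof. by elim: m f => [//|m IH] f /=; rewrite !IH mulrDr. Qed.

Lemma bsum_rcons m f :
  bsum m.+1 f = bsum m (fun u => f (rcons u false)) + bsum m (fun u => f (rcons u true)).
Proof.
elim: m f => [//|m IH] f.
rewrite -[LHS]/(bsum m.+1 (fun u => f (false :: u)) + bsum m.+1 (fun u => f (true :: u))).
by rewrite (IH (fun u => f (false :: u))) (IH (fun u => f (true :: u))) /= addrACA.
Qed.

(** The coefficient of nested caps whose left legs carry the bits [u]; their right legs then carry
    [mirror u]. *)
Definition cap_weight (u : seq bool) : K := \prod_(b <- u) pairing b (~~ b).
Definition mirror (u : seq bool) : seq bool := rev [seq ~~ b | b <- u].

Lemma mirrorK u : mirror (mirror u) = u.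
Proof. by rewrite /mirror map_rev revK -map_comp map_id_in // => b _ /=; rewrite negbK. Qed.

Lemma size_mirror u : size (mirror u) = size u.
Proof. by rewrite size_rev size_map. Qed.

Lemma mirror_rcons u b : mirror (rcons u b) = ~~ b :: mirror u.
Proof. by rewrite /mirror map_rcons rev_rcons. Qed.

Lemma cap_weight_rcons u b : cap_weight (rcons u b) = cap_weight u * pairing b (~~ b).
Proof. by rewrite /cap_weight -cats1 big_cat big_seq1. Qed.

Definition signs i m : K := \prod_(j < m) eta ^+ (i + j).

Lemma signs_sq i m : signs i m * signs i m = 1.
Proof.
rewrite /signs -big_split big1 // => j _ /=.
by rewrite -exprMn -expr2 eta2 expr1n.
Qed.

(** Nested caps are applied from the innermost outwards, at positions [i + m.-1] down to [i]; each
    contributes [om] and the sign of its position. *)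
Lemma TL_close m i i' v c : TL (i + m.*2 + i') v c ->
  TL (i + i') (fun l => bsum m (fun u =>
    cap_weight u * v (take i l ++ u ++ mirror u ++ drop i l))) (om ^+ m * signs i m * c).
Proof.
elim: m v c => [|m IH] v c h.
  rewrite addn0 in h; apply: (TL_ext h) => [l _|] /=.
    by rewrite /cap_weight big_nil mul1r cat_take_drop.
  by rewrite /signs big_ord0 !mul1r.
have h' : TL (i + m.*2 + i').+2 v c by rewrite doubleS !addnS !addSn in h.
have pk : (i + m <= i + m.*2 + i')%N by rewrite -addnn; lia.
apply: (TL_ext (IH _ _ (TL_cap h' pk))) => [l sl|]; last first.
  by rewrite /signs big_ord_recr exprS /=; ring.
rewrite bsum_rcons -bsumD; apply: eq_bsum => u su.
have sz : size (take i l ++ u) = (i + m)%N by rewrite size_cat size_takel ?sl ?leq_addr // su.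
rewrite catA -sz capE !cap_weight_rcons !mirror_rcons !cat_rcons -!catA /=; ring.
Qed.

Definition nested m (l : seq bool) : K :=
  cap_weight (take m l) * (drop m l == mirror (take m l))%:R.

Lemma nestedE u1 u2 : nested (size u1) (u1 ++ u2) = cap_weight u1 * (u2 == mirror u1)%:R.
Proof. by rewrite /nested take_size_cat // drop_size_cat. Qed.

Lemma TL_nested m : TL m.*2 (nested m) (signs 0 m).
Proof.
elim: m => [|m IH].
  apply: (TL_ext TL_unit) => [l /size0nil ->|]; last by rewrite /signs big_ord0.
  by rewrite /nested /cap_weight big_nil /mirror eqxx mulr1.
have pk : (m <= m.*2)%N by rewrite -addnn leq_addr.
apply: (TL_ext (TL_cup pk IH)) => [l sl|]; last first.
  by rewrite /signs big_ord_recr mulrC.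
have [|u1 [u' [-> z1 z']]] := @split_size _ l m m.+2; first by rewrite sl -addnn !addnS.
case: u' z' => [//|a [//|b u2]] _; rewrite -[in LHS]z1 cupE nestedE.
rewrite -cat_rcons -{1}z1 -(size_rcons u1 a) nestedE cap_weight_rcons mirror_rcons eqseq_cons.
by case: a; case: b => /=; ring.
Qed.

End TemperleyLieb.

(** * From Links-Gould to ADO *)

(* By Cayley-Hamilton, [A^-1] and [B^-1] are one and the same polynomial in [A] and [B]. *)
Lemma unitmx_inv_ind (K : fieldType) (n1 n2 : nat) (A : 'M[K]_n1) (B : 'M[K]_n2)
    (P : 'M[K]_n1 -> 'M[K]_n2 -> Prop) :
  (0 < n1)%N -> (0 < n2)%N -> A \in unitmx -> B \in unitmx -> P 0 0 ->
  (forall M N c, P M N -> P (A *m M + c%:M) (B *m N + c%:M)) -> P (invmx A) (invmx B).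
Proof.
case: n1 A P => // n1 A P; case: n2 B P => // n2 B P _ _ uA uB P0 Pstep.
have PH q : P (horner_mx A q) (horner_mx B q).
  elim/poly_ind: q => [|q c IH]; first by rewrite !rmorph0.
  by rewrite mulrC !rmorphD !rmorphM /= !horner_mx_X !horner_mx_C; apply: Pstep.
pose p := char_poly A * char_poly B.
have pA : horner_mx A p = 0 by rewrite rmorphM /= Cayley_Hamilton mul0r.
have pB : horner_mx B p = 0 by rewrite rmorphM /= Cayley_Hamilton mulr0.
have p0 : p`_0 != 0.
  rewrite coef0M !char_poly_det !mulf_neq0 ?signr_eq0 // -unitfE; [exact: uA|exact: uB].
have [q [c ep]] : exists q c, p = q * 'X + c%:P.
  by elim/poly_ind: p {pA pB p0} => [|q c _]; [exists 0, 0; rewrite mul0r add0r|exists q, c].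
have c0 : c != 0 by move: p0; rewrite ep coefD coefMX coefC add0r.
have inv m (C : 'M[K]_m.+1) : C \in unitmx -> horner_mx C p = 0 ->
    invmx C = horner_mx C (- c^-1 *: q).
  rewrite ep mulrC rmorphD rmorphM /= horner_mx_X horner_mx_C => uC /eqP.
  rewrite addr_eq0 => /eqP e; rewrite linearZ /=.
  apply: (can_inj (mulKmx uC)); rewrite mulmxV // -scalemxAr -[C *m _]/(C * _) e.
  by rewrite scaleNr scalerN opprK scale_scalar_mx mulVf.
by rewrite (inv _ _ uA pA) (inv _ _ uB pB).
Qed.

Lemma lop_horner (K : fieldType) (m n k : nat)
    (f : 'I_m.+1 * 'I_m.+1 -> 'I_m.+1 * 'I_m.+1 -> K)
    (M : 'M[K]_#|{: 'I_m.+1 * 'I_m.+1}|) c phi x :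
  (k.+1 < n)%N -> valid m.+1 n x ->
  c * phi x + lop f k (lop (fun p q => M (enum_rank p) (enum_rank q)) k phi) x =
  lop (fun p q => (mxo f *m M + c%:M) (enum_rank p) (enum_rank q)) k phi x.
Proof.
move=> hk vx; rewrite (lop_comp (n := n)) //.
rewrite -[phi x](@lop_id _ m n (fun p q => (p == q)%:R) k) // -lop_scale /lop -big_split.
apply: eq_bigr => q _ /=; rewrite mulrCA mulrA -mulrDl; congr (_ * _).
set p := (_, _); rewrite !mxE (inj_eq enum_rank_inj) addrC mulr_natr; congr (_ + _).
rewrite (reindex _ (onW_bij _ (enum_rank_bij _))) /=.
by apply: eq_bigr => r _; rewrite mxE !enum_rankK.
Qed.

(** * The diagonal gauge between the two R-matrices *)

Section Gauge.
Variables (K : fieldType) (e0 eta d2 : K).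
Hypotheses (e0_sqr : e0 ^+ 2 = 1) (eta2 : eta ^+ 2 = 1) (d20 : d2 != 0).

(** Moving a 1 past a 0 changes the value by [e0], and past a 2 by [e0 eta]: these are the signs in
    [s0] and [s1]. When 11 is replaced by 02 or 20 with p ones to the left, the sign [eta^p] of the
    cup at position p appears. *)
Fixpoint gauge (l : seq nat) : K :=
  match l with
  | [::] => 1
  | 0 :: l' => gauge l'
  | 1 :: l' => e0 ^+ size l' * eta ^+ count_mem 2%N l' * gauge l'
  | _ :: l' => d2 * gauge l'
  end.

Lemma sign_neq0 (e : K) k : e ^+ 2 = 1 -> e ^+ k != 0.
Proof.
move=> h; apply: expf_neq0; apply/eqP => e0'; move: h; rewrite e0' expr0n /=.
by move/esym/eqP; rewrite oner_eq0.
Qed.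

Lemma gauge_neq0 l : gauge l != 0.
Proof.
elim: l => [|[|[|a]] l IH] /=; rewrite ?oner_neq0 ?mulf_neq0 ?sign_neq0 //.
Qed.

(* The values of [gauge] on a context [l1 ++ i :: j :: l2] up to a common factor, where [h]
   and [a] are the signs depending on [l1] and [l2]. *)
Definition local_gauge (h a : K) (i j : nat) : K :=
  match i, j with
  | 0, 0 => 1 | 0, 1 => a | 1, 0 => e0 * a | 1, 1 => e0
  | 0, 2 => d2 * h | 2, 0 => d2 * h | 1, 2 => e0 * eta * a * d2 * h
  | 2, 1 => d2 * a * h | _, _ => d2 ^+ 2
  end.

Fixpoint gauge_prefix (l : seq nat) (r : nat) : K :=
  match l with
  | [::] => 1
  | 0 :: l' => gauge_prefix l' r
  | 1 :: l' => e0 ^+ (size l' + r) * eta ^+ count_mem 2%N l' * gauge_prefix l' r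
  | _ :: l' => d2 * gauge_prefix l' r
  end.

Lemma gauge_cat l1 l2 : gauge (l1 ++ l2) =
  gauge_prefix l1 (size l2) * eta ^+ (count_mem 1%N l1 * count_mem 2%N l2) * gauge l2.
Proof.
elim: l1 => [|[|[|i]] l1 IH] /=; rewrite ?IH ?mul0n ?expr0 ?mul1r //.
- by rewrite size_cat count_cat mulnDl mul1n !exprD; ring.
- by ring.
Qed.

Lemma gauge_ctx l1 l2 : exists Q a, forall i j, (i < 3)%N -> (j < 3)%N ->
  gauge (l1 ++ i :: j :: l2) = Q * local_gauge (eta ^+ count_mem 1%N l1) a i j.
Proof.
set p := count_mem 1%N l1; set c := count_mem 2%N l2.
exists (gauge_prefix l1 (size l2).+2 * eta ^+ (p * c) * gauge l2), (e0 ^+ size l2 * eta ^+ c).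
have sq (e : K) k : e ^+ 2 = 1 -> (e ^+ k) ^+ 2 = 1.
  by move=> h; rewrite exprAC h expr1n.
move=> i j li lj; rewrite gauge_cat -/p.
have X := sq e0 (size l2) e0_sqr; have Y := sq eta c eta2; have Z := sq eta p eta2.
do 3?[case: i li => [|i] li //]; do 3?[case: j lj => [|j] lj //];
  rewrite /= -/c ?mulnDr ?muln1 ?muln0 ?add0n ?exprD ?exprS ?expr0 //=;
  move: (e0 ^+ size l2) (eta ^+ c) (eta ^+ p) X Y Z => x' y' z' X Y Z; ring: X Y Z.
Qed.

End Gauge.

(** * Matching the Links-Gould and ADO operators, and comparing their traces *)

Section Comparison.
Variables (K : fieldType) (om t s0 s1 y e0 eta : K) (n : nat).
Hypotheses (om0 : om != 0) (om2 : om ^+ 2 = om - 1) (t0 : t != 0) (nz1 : t ^+ 2 - 1 != 0).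
Hypotheses (e0_sqr : e0 ^+ 2 = 1) (eta2 : eta ^+ 2 = 1).
Hypotheses (s0E : s0 = e0 * t) (s1E : s1 = - (e0 * eta * om / t)).
Hypotheses (y0 : y != 0) (y2 : y ^+ 2 = (t ^+ 2 - 1) * (1 - om ^+ 2 * t ^- 2)).

Local Notation s := (s0 * s1).
Local Notation cup := (cup s).
Local Notation cap := (cap s).
Local Notation TL := (TL s eta).

(* The value of the gauge at the label 2 is forced by the entries [11 -> 20] and
   [20 -> 11] of the two R-matrices. *)
Definition gauge2 : K := - (y * om * e0) / (t - t^-1).
Local Notation G := (gauge e0 eta gauge2).

Let sE : s = - (eta * om).
Proof. by rewrite s0E s1E; field: e0_sqr. Qed.

Let s2 : s ^+ 2 = om - 1.
Proof. by rewrite sE; ring: eta2 om2. Qed.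

Let eta_om : eta * om = - s.
Proof. by rewrite sE opprK. Qed.

Let tt0 : t - t^-1 != 0.
Proof.
apply: contra nz1 => /eqP e; apply/eqP.
by have -> : t ^+ 2 - 1 = t * (t - t^-1) by [field]; rewrite e mulr0.
Qed.

Let gauge2_1 : gauge2 * (t - t^-1) = - (y * om * e0).
Proof. by rewrite /gauge2 mulfVK. Qed.

(** The second condition on the gauge at the label 2; it is compatible with the first exactly
    through the formula for [y^2]. *)
Let gauge2_2 : e0 * (t^-1 + om * t) = - (y * gauge2).
Proof.
apply: (mulIf tt0); rewrite mulNr -(mulrA y) gauge2_1.
transitivity (y ^+ 2 * om * e0); last by ring.
rewrite y2; field: om2; exact: t0.
Qed.

(* The ADO labels 0, 1, 2 correspond to the Links-Gould labels 0, {1, 2}, 3: [join l u]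
   refines the labels 1 of [l] by the bits of [u]. *)
Fixpoint join (l : seq nat) (u : seq bool) : seq nat :=
  match l with
  | [::] => [::]
  | 0 :: l' => 0 :: join l' u
  | 1 :: l' => (if head false u then 2 else 1) :: join l' (behead u)
  | _ :: l' => 3 :: join l' u
  end%N.

Local Notation ones := (count_mem 1%N).

Lemma join_cat l1 l2 u1 u2 : size u1 = ones l1 ->
  join (l1 ++ l2) (u1 ++ u2) = join l1 u1 ++ join l2 u2.
Proof.
elim: l1 u1 => [|[|[|a]] l1 IH] u1 //=; first by move/size0nil ->.
- by rewrite add0n => e; rewrite IH.
- by case: u1 => [//|b u1] [e] /=; rewrite IH.
- by rewrite add0n => e; rewrite IH.
Qed.

Lemma size_join l u : size (join l u) = size l.
Proof. by elim: l u => [|[|[|a]] l IH] u //=; rewrite IH. Qed.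

Lemma valid_join l u : valid 3 n l -> valid 4 n (join l u).
Proof.
rewrite /valid size_join => /andP [-> /=].
elim: l u => [|[|[|[|a]]] l IH] u //= al; rewrite IH //.
by case: (head false u).
Qed.

(* [F x u]: an operator with row [x], whose column has been dualised into the [j] bits [u]
   (the doublet being self-dual).  Its blocks are Temperley-Lieb tensors, and their values
   are, up to the gauge, the entries of the operator [g] on reversed lists. *)
Definition matched j (F : seq nat -> seq bool -> K) (g : seq nat -> K) : Prop :=
  forall l, valid 3 n l -> exists v, TL (ones l + j) v (G l * g (rev l)) /\
    forall u1 u2, size u1 = ones l -> size u2 = j -> F (join l u1) u2 = v (u1 ++ u2).

Lemma eq_matched j F F' g g' : matched j F g ->
  (forall x u, valid 4 n x -> F x u = F' x u) -> (forall l, valid 3 n l -> g l = g' l) ->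
  matched j F' g'.
Proof.
move=> h eF eg l vl; have [v [tl e]] := h l vl; exists v.
rewrite -eg ?valid_rev //; split=> // u1 u2 z1 z2; rewrite -eF ?e //.
exact: valid_join.
Qed.

Lemma matched_zero j : matched j (fun _ _ => 0) (fun _ => 0).
Proof. by move=> l vl; exists (fun=> 0); rewrite mulr0; split=> //; exact: TL_zero. Qed.

Lemma matched_lin j a F F' g g' : matched j F g -> matched j F' g' ->
  matched j (fun x u => a * F x u + F' x u) (fun l => a * g l + g' l).
Proof.
move=> h h' l vl; have [v [tl e]] := h l vl; have [v' [tl' e']] := h' l vl.
exists (fun u => a * v u + v' u); split; last by move=> u1 u2 z1 z2; rewrite e ?e'.
by apply: (TL_ext (TL_lin a tl tl')) => //; ring.
Qed.

(** Nine cases, by the ADO labels [a] and [b] at the letter. Each Links-Gould row is a combination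
    of cups and caps at position [ones l1]; its value is compared, up to [local_gauge], with the ADO
    row [(b, a)], swapped because [g] is read on reversed lists. *)
Lemma matched_letter j k F g : (k.+1 < n)%N -> matched j F g ->
  matched j (fun x u => lop (Rpair (LG_R s0 s1 y)) k (F^~ u) x)
            (lop (Rpair (ADO_R om t)) (n.-2 - k) g).
Proof.
move=> hk h l vl; have [l1 [a [b [l2 [el sz la lb]]]]] := valid_split vl hk.
have [/eqP szl _] := andP vl.
have sz2 : (n.-2 - k = size (rev l2))%N.
  by rewrite size_rev -szl el size_cat /= sz; lia.
have revE c d : rev (l1 ++ c :: d :: l2) = rev l2 ++ d :: c :: rev l1.
  by rewrite rev_cat !rev_cons -!cats1 -!catA.
have [Q [al GE]] := gauge_ctx gauge2 e0_sqr eta2 l1 l2.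
set h1 := eta ^+ ones l1 in GE.
have h12 : h1 ^+ 2 = 1 by rewrite /h1 exprAC eta2 expr1n.
set N := (ones l1 + ones l2 + j)%N.
have degE c d : (ones (l1 ++ c :: d :: l2) + j = (c == 1) + (d == 1) + N)%N.
  by rewrite count_cat /= /N; ring.
have H c d : (c < 3)%N -> (d < 3)%N -> exists v,
    TL ((c == 1) + (d == 1) + N)%N v
      (Q * local_gauge e0 eta gauge2 h1 al c d * g (rev l2 ++ d :: c :: rev l1))
    /\ forall q ub r u2, size q = ones l1 -> size ub = ones [:: c; d] ->
       size r = ones l2 -> size u2 = j ->
       F (join l1 q ++ join [:: c; d] ub ++ join l2 r) u2 = v (q ++ ub ++ r ++ u2).
  move=> lc ld; have [|v [tl e]] := h (l1 ++ c :: d :: l2).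
    by rewrite el in vl; exact: valid_ctx vl lc ld.
  exists v; rewrite -GE // -degE -revE; split=> // q ub r u2 zq zb zr z2.
  rewrite -join_cat // -join_cat // (e (q ++ ub ++ r) u2) // -?catA //.
  by rewrite !size_cat zq zb zr count_cat /=; ring.
suff [v [tl ev]] : exists v, TL ((a == 1) + (b == 1) + N)%N v
     (Q * local_gauge e0 eta gauge2 h1 al a b *
      ADO_row om t b a (fun c d => g (rev l2 ++ c :: d :: rev l1)))
   /\ forall q ub r u2, size q = ones l1 -> size ub = ones [:: a; b] ->
        size r = ones l2 -> size u2 = j ->
        lop (Rpair (LG_R s0 s1 y)) (size (join l1 q)) (F^~ u2)
          (join l1 q ++ join [:: a; b] ub ++ join l2 r) = v (q ++ ub ++ r ++ u2).
  exists v; rewrite el revE sz2 lop_ADO // GE // degE; split=> // u1 u2.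
  rewrite count_cat => z1 z2.
  have [q [u' [-> zq]]] := split_size z1.
  rewrite -[ones (a :: _)]/(ones ([:: a; b] ++ l2)) count_cat => z'.
  have [ub [r [-> zb zr]]] := split_size z'.
  by rewrite -!catA -ev // size_join sz -join_cat // -join_cat.
have [v00 [T00 F00]] := H 0 0 isT isT.
have [v01 [T01 F01]] := H 0 1 isT isT.
have [v02 [T02 F02]] := H 0 2 isT isT.
have [v10 [T10 F10]] := H 1 0 isT isT.
have [v11 [T11 F11]] := H 1 1 isT isT.
have [v12 [T12 F12]] := H 1 2 isT isT.
have [v20 [T20 F20]] := H 2 0 isT isT.
have [v21 [T21 F21]] := H 2 1 isT isT.
have [v22 [T22 F22]] := H 2 2 isT isT.
have pN : (ones l1 <= N)%N by rewrite /N -addnA leq_addr.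
case: a b la lb {el} => [|[|[|//]]] [|[|[|//]]] _ _.
- exists (fun l => s0 ^+ 2 * v00 l); split.
    by apply: (TL_ext (TL_scale _ T00)) => //=; rewrite s0E; ring: e0_sqr.
  move=> q [|//] r u2 zq _ zr z2; rewrite lop_LG //=.
  by have /= -> := F00 q [::] r u2 zq erefl zr z2.
- exists (fun l => s0 * v10 l); split.
    by apply: (TL_ext (TL_scale _ T10)) => //=; rewrite s0E; ring: e0_sqr.
  move=> q [//|c [|//]] r u2 zq _ zr z2; have /= := F10 q [:: c] r u2 zq erefl zr z2.
  by case: c => /= <-; rewrite lop_LG.
- exists v20; split; first by apply: (TL_ext T20).
  move=> q [|//] r u2 zq _ zr z2; rewrite lop_LG //=.
  by have /= -> := F20 q [::] r u2 zq erefl zr z2.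
- exists (fun l => s0 * v01 l + (s0 ^+ 2 - 1) * v10 l); split.
    by apply: (TL_ext (TL_lin _ T01 (TL_scale _ T10))) => //=; rewrite s0E; ring: e0_sqr.
  move=> q [//|c [|//]] r u2 zq _ zr z2; have /= := F10 q [:: c] r u2 zq erefl zr z2.
  have /= := F01 q [:: c] r u2 zq erefl zr z2.
  by case: c => /= <- <-; rewrite lop_LG.
(* On two doublets the Links-Gould block is minus the identity plus the cup after the cap, together
   with a bare cup from the channel with labels 3, 0. The values match by [om^2 = om - 1] and
   [gauge2_2]. *)
- exists (fun l => -1 * v11 l + (- y * cup (ones l1) v20 l + cup (ones l1) (cap (ones l1) v11) l)).
  split.
    apply: (TL_ext (TL_lin (-1) T11 (TL_lin (- y) (TL_cup pN T20)
      (TL_cup pN (TL_cap s2 eta2 eta_om T11 pN))))) => //=.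
    rewrite -/h1 om2.
    transitivity (Q * (e0 * (om - 1) * g (rev l2 ++ [:: 1%N, 1%N & rev l1]) + - (y * gauge2) *
      g (rev l2 ++ [:: 0%N, 2%N & rev l1]))); first by ring: h12.
    by rewrite -gauge2_2; ring.
  move=> q [//|c [//|d [|//]]] r u2 zq _ zr z2; rewrite -zq !cupE !capE.
  have /= f20 := F20 q [::] r u2 zq erefl zr z2.
  have f11 b1 b2 := F11 q [:: b1; b2] r u2 zq erefl zr z2.
  rewrite -f20 -!f11 /=.
  by case: c; case: d; rewrite /= lop_LG //=; ring.
- exists (fun l => s1 * v21 l); split.
    by apply: (TL_ext (TL_scale _ T21)) => //=; rewrite s1E; field: e0_sqr eta2.
  move=> q [//|c [|//]] r u2 zq _ zr z2; have /= := F21 q [:: c] r u2 zq erefl zr z2.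
  by case: c => /= <-; rewrite lop_LG.
(* The transition to two doublets is [- y] times the cap; [gauge2_1] matches its value. *)
- exists (fun l => 1 * v02 l + (y ^+ 2 * v20 l + - y * cap (ones l1) v11 l)); split.
    apply: (TL_ext (TL_lin 1 T02 (TL_lin (y ^+ 2) T20
      (TL_scale (- y) (TL_cap s2 eta2 eta_om T11 pN))))) => //=.
    rewrite -/h1 y2.
    transitivity (Q * h1 * (gauge2 * g (rev l2 ++ [:: 2%N, 0%N & rev l1])
      + (t ^+ 2 - 1) * (1 - om ^+ 2 / t ^+ 2) * gauge2 * g (rev l2 ++ [:: 0%N, 2%N & rev l1])
      + - (y * om * e0) * g (rev l2 ++ [:: 1%N, 1%N & rev l1]))); first by ring.
    by rewrite -gauge2_1; ring.
  move=> q [|//] r u2 zq _ zr z2; rewrite -zq capE.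
  have /= f20 := F20 q [::] r u2 zq erefl zr z2.
  have /= f02 := F02 q [::] r u2 zq erefl zr z2.
  have f11 b1 b2 := F11 q [:: b1; b2] r u2 zq erefl zr z2.
  by rewrite -f20 -f02 -!f11 /= lop_LG //=; ring.
- exists (fun l => s1 * v12 l + (s1 ^+ 2 - 1) * v21 l); split.
    by apply: (TL_ext (TL_lin _ T12 (TL_scale _ T21))) => //=; rewrite s1E; field: e0_sqr eta2.
  move=> q [//|c [|//]] r u2 zq _ zr z2; have /= := F21 q [:: c] r u2 zq erefl zr z2.
  have /= := F12 q [:: c] r u2 zq erefl zr z2.
  by case: c => /= <- <-; rewrite lop_LG.
- exists (fun l => s1 ^+ 2 * v22 l); split.
    by apply: (TL_ext (TL_scale _ T22)) => //=; rewrite s1E; field: e0_sqr eta2.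
  move=> q [|//] r u2 zq _ zr z2; rewrite lop_LG //=.
  by have /= -> := F22 q [::] r u2 zq erefl zr z2.
Qed.

(** The inverses are reached by Horner steps of one common polynomial, and each step preserves
    matching by [matched_letter] and [matched_lin]. *)
Lemma matched_inverse j k F g : (k.+1 < n)%N -> matched j F g ->
  matched j (fun x u => lop (Rinvpair (LG_R s0 s1 y)) k (F^~ u) x)
            (lop (Rinvpair (ADO_R om t)) (n.-2 - k) g).
Proof.
move=> hk; move: F g; have hk' : ((n.-2 - k).+1 < n)%N by lia.
have s00 : s0 != 0 by rewrite s0E mulf_neq0 // -(expr1 e0) sign_neq0.
have s10 : s1 != 0.
  rewrite s1E oppr_eq0 !mulf_neq0 ?invr_neq0 //; last by rewrite -(expr1 eta) sign_neq0.
  by rewrite -(expr1 e0) sign_neq0.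
apply: (@unitmx_inv_ind K _ _ _ _ (fun M N => forall F g, matched j F g ->
  matched j (fun x u => lop (fun p q => M (enum_rank p) (enum_rank q)) k (F^~ u) x)
    (lop (fun p q => N (enum_rank p) (enum_rank q)) (n.-2 - k) g)) _ _
    (LG_unit y s00 s10) (ADO_unit om0 t0)).
- by rewrite card_prod !card_ord.
- by rewrite card_prod !card_ord.
- move=> F g _; apply: (eq_matched (matched_zero j)) => [x u _|l _];
    by rewrite /lop big1 // => p _; rewrite mxE mul0r.
move=> M N c IH F g h.
apply: (eq_matched (matched_lin c h (matched_letter hk (IH F g h)))) => [x u vx|l vl].
  exact: lop_horner hk vx.
exact: lop_horner hk' vl.
Qed.

Lemma matched_word j w F g : wf_braid n w -> matched j F g ->
  matched j (fun x u => ev (LG_R s0 s1 y) w (F^~ u) x) (ev (ADO_R om t) (rev_word n w) g).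
Proof.
elim: w => [//|[k [|]] w IH] /= /andP [hk hw] h.
  by apply: matched_letter hk _; exact: IH.
by apply: matched_inverse hk _; exact: IH.
Qed.

Lemma join_inj l u u' : size u = ones l -> size u' = ones l ->
  join l u = join l u' -> u = u'.
Proof.
elim: l u u' => [|[|[|a]] l IH] u u' /=.
- by move=> /size0nil -> /size0nil ->.
- by rewrite add0n => z z' [e]; exact: IH.
- case: u u' => [//|b u] [//|b' u'] [z] [z'] [] eb e; congr (_ :: _); last exact: IH.
  by case: b b' eb => -[].
- by rewrite add0n => z z' [e]; exact: IH.
Qed.

Lemma join_injl l l' u u' : all (gtn 3) l -> all (gtn 3) l' ->
  join l u = join l' u' -> l = l'.
Proof.
elim: l l' u u' => [|a l IH] [|a' l'] u u' //.
- by case: a' => [|[|a']].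
- by case: a => [|[|a]].
case: a a' => [|[|[|a]]] [|[|[|a']]] //= al al' []; do ?by case: head.
- by move=> e; rewrite (IH _ _ _ al al' e).
- by move=> _ e; rewrite (IH _ _ _ al al' e).
- by move=> e; rewrite (IH _ _ _ al al' e).
Qed.

(** Bending the identity of the doublets gives nested cups. [cap_weight] is the coefficient of the
    bent basis column, and the extra [signs], which squares to 1, makes the value equal to [G l]. *)
Lemma matched_delta l : valid 3 n l ->
  matched (ones l) (fun x u => signs eta 0 (ones l) * G l * cap_weight s (mirror u) *
                                delta K (join l (mirror u)) x) (delta K (rev l)).
Proof.
move=> vl l' vl'; have [->|ne] := eqVneq l' l; last first.
  exists (fun=> 0); split.
    by rewrite /delta (inj_eq (can_inj revK)) (negPf ne) mulr0; exact: TL_zero.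
  move=> u1 u2 z1 z2; rewrite /delta; case: eqP => [e|]; last by rewrite mulr0.
  case/andP: vl => _ al; case/andP: vl' => _ al'.
  by case/eqP: ne; exact: join_injl al' al e.
exists (fun u => signs eta 0 (ones l) * G l * nested s (ones l) u); split.
  have tl := TL_scale (signs eta 0 (ones l) * G l) (TL_nested s eta (ones l)).
  rewrite addnn; apply: (TL_ext tl) => //.
  by rewrite /delta eqxx mulr1 mulrAC signs_sq // mul1r.
move=> u1 u2 z1 z2; rewrite -{3}z1 nestedE -!mulrA; congr (_ * (_ * _)).
rewrite /delta; have [->|ne] := eqVneq u2 (mirror u1); first by rewrite mirrorK eqxx.
case: eqP => [e|]; last by rewrite !mulr0.
case/eqP: ne; rewrite -[u2]mirrorK; congr mirror; apply/esym.
by apply: join_inj e; rewrite ?size_mirror.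
Qed.

Lemma ev_scale (m : nat) (R : 'I_m.+1 -> 'I_m.+1 -> 'I_m.+1 -> 'I_m.+1 -> K) w c phi x :
  ev R w (fun x => c * phi x) x = c * ev R w phi x.
Proof.
elim: w x => [//|l w IH] x /=; rewrite -lop_scale /lop.
by apply: eq_bigr => p _; rewrite IH.
Qed.

Local Notation A w x := (ev (LG_R s0 s1 y) w (delta K x) x).
Local Notation B w l := (ev (ADO_R om t) (rev_word n w) (delta K (rev l)) (rev l)).

Lemma matched_diag w l : wf_braid n w -> valid 3 n l ->
  exists v, TL (ones l + ones l) v (G l * B w l) /\
    forall u, size u = ones l ->
      signs eta 0 (ones l) * G l * cap_weight s u * A w (join l u) = v (u ++ mirror u).
Proof.
move=> hw vl; have [v [tl e]] := matched_word hw (matched_delta vl) vl.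
exists v; split=> // u zu; rewrite -e ?size_mirror // ev_scale mirrorK //.
Qed.

Let G0 l : G l != 0.
Proof.
apply: gauge_neq0 => //; rewrite /gauge2 mulf_neq0 ?invr_neq0 // oppr_eq0.
by rewrite !mulf_neq0 // -(expr1 e0) sign_neq0.
Qed.

Let signs0 i m : signs eta i m != 0.
Proof.
apply/eqP => e; have := signs_sq eta2 i m; rewrite e mul0r => /esym/eqP.
by rewrite oner_eq0.
Qed.

(** Closing all bits with nested caps lands in degree 0. One factor [cap_weight] comes from
    [matched_delta], the other from the caps. *)
Lemma closed_sum w l : wf_braid n w -> valid 3 n l ->
  bsum (ones l) (fun u => cap_weight s u ^+ 2 * A w (join l u)) = om ^+ ones l * B w l.
Proof.
move=> hw vl; have [v [tl e]] := matched_diag hw vl.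
have tl' : TL (0 + (ones l).*2 + 0) v (G l * B w l) by rewrite addn0 add0n -addnn.
have /= := (TL_small (TL_close s2 eta2 eta_om tl')).1 erefl.
rewrite (eq_bsum (g := fun u => signs eta 0 (ones l) * G l *
  (cap_weight s u ^+ 2 * A w (join l u)))) => [|u zu]; last first.
  by rewrite cats0 -e //; ring.
rewrite bsumZ => e'; apply: (mulfI (mulf_neq0 (signs0 0 (ones l)) (G0 l))).
by rewrite e'; ring.
Qed.

(** Leaving the doublet of the first strand open lands in degree 2, where the tensor is a multiple
    of [pairing]; hence the result does not depend on [b]. *)
Lemma open_sum w l b : wf_braid n w -> valid 3 n (1%N :: l) ->
  bsum (ones l) (fun u => cap_weight s u ^+ 2 * A w (join (1%N :: l) (b :: u))) =
  om ^+ ones l * B w (1%N :: l).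
Proof.
move=> hw vl; have [v [tl e]] := matched_diag hw vl.
set c := G _ * _ in tl.
have tl' : TL (1 + (ones l).*2 + 1) v c.
  by move: tl; rewrite /= !add1n addn1 addnS addSn addnn.
have pb0 : pairing s b (~~ b) != 0.
  case: b => /=; first by rewrite oppr_eq0 oner_eq0.
  by rewrite sE oppr_eq0 mulf_neq0 // -(expr1 eta) sign_neq0.
have /= := (TL_small (TL_close s2 eta2 eta_om tl')).2 erefl b (~~ b).
have sg : signs eta 0 (ones (1%N :: l)) = signs eta 1 (ones l).
  by rewrite /signs /= big_ord_recl expr0 mul1r; apply: eq_bigr => j _; rewrite add0n.
rewrite (eq_bsum (g := fun u => signs eta 1 (ones l) * G (1%N :: l) * pairing s b (~~ b) *
  (cap_weight s u ^+ 2 * A w (join (1%N :: l) (b :: u))))) => [|u zu]; last first.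
  have -> : b :: u ++ mirror u ++ [:: ~~ b] = (b :: u) ++ mirror (b :: u).
    by rewrite /mirror /= rev_cons -cats1 catA.
  rewrite -e; last by rewrite /= zu.
  by rewrite sg [cap_weight s (b :: u)]/cap_weight big_cons -/(cap_weight s u); ring.
rewrite bsumZ => e'; apply: (mulfI (mulf_neq0 (mulf_neq0 (signs0 1 (ones l)) (G0 (1%N :: l))) pb0)).
by rewrite e' /c; ring.
Qed.

Definition LG_weight (a : nat) : K :=
  match a with
  | 0 => (s0 ^+ 2)^-1 | 1 => - s1 ^+ 2 | 2 => - (s0 ^+ 2)^-1 | _ => s1 ^+ 2
  end.

(** The surplus [om^-1] per doublet cancels the loop value in [closed_sum] and [open_sum], and the
    squares are the two factors [cap_weight] found there. *)
Lemma prod_join l u : all (gtn 3) l -> size u = ones l ->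
  \prod_(a <- join l u) LG_weight a =
  \prod_(a <- l) left_weight om t a * om ^- ones l * cap_weight s u ^+ 2.
Proof.
have s02 : s0 ^+ 2 = t ^+ 2 by rewrite s0E; ring: e0_sqr.
have s12 : s1 ^+ 2 = om ^+ 2 / t ^+ 2 by rewrite s1E; field: e0_sqr eta2.
elim: l u => [|[|[|[|a]]] l IH] u //= al.
- by move/size0nil => ->; rewrite /cap_weight !big_nil expr0 invr1 expr1n !mulr1.
- by rewrite add0n => z; rewrite !big_cons IH //= /left_weight s02; ring.
- case: u => [//|b u] [z]; rewrite !big_cons IH //= /cap_weight big_cons -/(cap_weight s u).
  have -> : om ^- (1 + ones l) = om^-1 * om ^- ones l by rewrite exprD expr1 invfM.
  move: (om ^- ones l) (\prod_(a <- l) left_weight om t a) => o P; rewrite /left_weight expr1.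
  case: b => /=; rewrite ?s02 ?s12; first by field; rewrite om0 t0.
  by rewrite exprMn s2 -om2; field; rewrite om0 t0.
- by rewrite add0n => z; rewrite !big_cons IH //= /left_weight s12; ring.
Qed.

Lemma lsumD m k (f g : seq nat -> K) :
  lsum m k (fun x => f x + g x) = lsum m k f + lsum m k g.
Proof.
elim: k f g => [//|k IH] f g /=; rewrite -big_split.
by apply: eq_bigr => c _; rewrite IH.
Qed.

Lemma lsum_join k (f : seq nat -> K) :
  lsum 4 k f = lsum 3 k (fun l => bsum (ones l) (fun u => f (join l u))).
Proof.
elim: k f => [//|k IH] f; rewrite /= !big_ord_recl !big_ord0 !addr0 !IH.
congr (_ + _); rewrite addrA; congr (_ + _).
by rewrite -lsumD; apply: eq_lsum.
Qed.

Lemma LG_sum w z : (0 < n)%N -> wf_braid n w ->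
  (forall a, (a < 3)%N -> lsum 3 n.-1 (fun l => \prod_(b <- l) left_weight om t b *
     ev (ADO_R om t) (rev_word n w) (delta K (rcons l a)) (rcons l a)) = z) ->
  4%:R != 0 :> K -> LG s0 s1 y n w = z.
Proof.
move=> n0 hw hz four.
rewrite /LG /braid_invariant (hop_diag (hd := LG_weight)) // mxtrace_diagm.
rewrite (eq_lsum (g := fun x => \prod_(a <- behead x) LG_weight a * A w x)); last first.
  by move=> x vx; rewrite entry_rho.
have [k en] : exists k, n = k.+1 by exists n.-1; rewrite prednK.
have ek : n.-1 = k by rewrite en.
rewrite ek in hz; have hz' a : (a < 3)%N ->
    lsum 3 k (fun l => \prod_(b <- l) left_weight om t b * B w (a :: l)) = z.
  move=> la; rewrite -(hz a la) -[RHS]lsum_rev; apply: eq_lsum => l _.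
  by rewrite rev_cons; congr (_ * _); apply: perm_big; rewrite perm_sym perm_rev.
rewrite lsum_join.
have vc a l : (a < 3)%N -> valid 3 k l -> valid 3 n (a :: l) by rewrite en valid_cons => -> ->.
have full a : (a < 3)%N -> a != 1%N ->
    lsum 3 k (fun l => bsum (ones (a :: l)) (fun u =>
      \prod_(b <- behead (join (a :: l) u)) LG_weight b * A w (join (a :: l) u))) = z.
  move=> la a1; rewrite -(hz' a la); apply: eq_lsum => l vl.
  have e1 : ones (a :: l) = ones l by rewrite /= (negPf a1).
  have vl' := vc a l la vl.
  have := closed_sum hw vl'; rewrite e1 => cs.
  rewrite (eq_bsum (g := fun u => \prod_(b <- l) left_weight om t b * om ^- ones l *
    (cap_weight s u ^+ 2 * A w (join (a :: l) u)))) => [|u zu].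
    by rewrite bsumZ cs -[_ * om ^- _ * _]mulrA mulKf ?expf_neq0.
  have -> : behead (join (a :: l) u) = join l u by case: a la a1 {e1 vl' cs} => [|[|a]].
  by case/andP: vl => _ al; rewrite prod_join // !mulrA.
have open1 b : lsum 3 k (fun l => bsum (ones l) (fun u =>
    \prod_(b <- join l u) LG_weight b * A w (join (1%N :: l) (b :: u)))) = z.
  rewrite -(hz' 1%N isT); apply: eq_lsum => l vl.
  rewrite (eq_bsum (g := fun u => \prod_(b <- l) left_weight om t b * om ^- ones l *
    (cap_weight s u ^+ 2 * A w (join (1%N :: l) (b :: u))))) => [|u zu].
    by rewrite bsumZ (open_sum b hw (vc 1%N l isT vl)) -[_ * om ^- _ * _]mulrA mulKf ?expf_neq0.
  by case/andP: vl => _ al; rewrite prod_join // !mulrA.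
(* The open strand contributes [z] for the label 0, [z] for each of the two doublet labels and [z]
   for the label 3, against the normalisation 1/4. *)
have -> : lsum 3 n (fun l => bsum (ones l) (fun u =>
    \prod_(b <- behead (join l u)) LG_weight b * A w (join l u))) = z + (z + z + z).
  rewrite {1}en -{1}(full 0%N isT isT) -{3}(full 2%N isT isT) -{1}(open1 false) -{1}(open1 true).
  rewrite -lsumD /= !big_ord_recl big_ord0 addr0.
  by [].
have -> : z + (z + z + z) = 4%:R * z by ring.
by rewrite mulKf.
Qed.

End Comparison.

(** * The sixth root of unity, nonvanishing by transcendence, and the conclusion *)

Lemma primitive6_sqr (K : fieldType) (om : K) :
  6.-primitive_root om -> om ^+ 2 = om - 1.
Proof.
move=> prim; have om6 := prim_expr_order prim.
have ne k : (0 < k < 6)%N -> om ^+ k != 1.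
  by move=> hk; rewrite -(prim_order_dvd prim) gtnNdvd //; lia.
have e3 : om ^+ 3 + 1 = 0.
  apply: (mulfI (_ : om ^+ 3 - 1 != 0)); first by rewrite subr_eq0 ne.
  by ring: om6.
apply/eqP; rewrite -subr_eq0; apply/eqP.
apply: (mulfI (_ : om + 1 != 0)); last by rewrite mulr0 -e3; ring.
by apply: contra (ne 2 isT); rewrite addr_eq0 => /eqP ->; rewrite sqrrN expr1n.
Qed.

Lemma transcendental_horner (K : fieldType) (t : K) (c : seq int) :
  (forall p : {poly rat}, p != 0 -> (map_poly (@ratr K) p).[t] != 0) ->
  last 0 c != 0 -> (Poly [seq z%:~R | z <- c]).[t] != 0 :> K.
Proof.
move=> ht lc; pose p : {poly rat} := Poly [seq z%:~R | z <- c].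
have -> : Poly [seq z%:~R | z <- c] = map_poly (@ratr K) p.
  rewrite map_Poly_id0; last exact: (ratr_int _ 0).
  by rewrite -map_comp; congr Poly; apply: eq_map => z /=; rewrite ratr_int.
apply: ht; apply: contraNneq lc => e.
have := congr1 (fun q : {poly rat} => q`_(size c).-1) e.
rewrite coef_Poly coef0 (_ : _`_(size c).-1 = (last 0 c)%:~R).
  by move/eqP; rewrite intr_eq0.
by rewrite -nth_last; case: c {p e} => [//|z c]; rewrite (nth_map 0).
Qed.

(* K: any field containing omega, t and the square roots needed to        *)
(* specialize LG at t0 = t^2, t1 = omega^2 t^{-2}; t is an indeterminate   *)
(* (transcendental over Q).  Links are given as closures of braid words.  *)
Theorem theorem1p8 (K : fieldType) (om t s0 s1 y : K) :
  6.-primitive_root om ->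
  (forall p : {poly rat}, p != 0 -> (map_poly (@ratr K) p).[t] != 0) ->
  s0 ^+ 2 = t ^+ 2 ->
  s1 ^+ 2 = om ^+ 2 * t ^- 2 ->
  y ^+ 2 = (s0 ^+ 2 - 1) * (1 - s1 ^+ 2) ->
  forall (n : nat) (w : braid_word), (0 < n)%N -> wf_braid n w ->
    ADO om t n w = LG s0 s1 y n w.
Proof.
move=> prim ht s02 s12 y2 n w n0 hw.
have om2 := primitive6_sqr prim.
have om0 : om != 0.
  by apply/eqP => e; move: om2; rewrite e expr0n sub0r => /eqP; rewrite eq_sym oppr_eq0 oner_eq0.
have ev c := @transcendental_horner K t c ht.
(* Transcendence applied to constant polynomials gives characteristic zero. *)
have natr_neq0 k : k.+1%:R != 0 :> K.
  by have := ev [:: k.+1%:Z] isT; rewrite horner_Poly /= mul0r add0r.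
have t0 : t != 0.
  by have := ev [:: 0; 1] isT; rewrite horner_Poly /= mul0r add0r mul1r addr0.
have nz1 : t ^+ 2 - 1 != 0.
  have := ev [:: -1; 0; 1] isT; rewrite horner_Poly /=.
  by congr (_ != 0); ring.
(* This is the norm over the rationals of [1 + om t^2], the conjugate of [om] being [1 - om]. It
   makes transcendence over the rationals apply to factors whose coefficients involve [om]. *)
have nz3 : t ^+ 4 + t ^+ 2 + 1 != 0.
  have := ev [:: 1; 0; 1; 0; 1] isT; rewrite horner_Poly /=.
  by congr (_ != 0); ring.
have nz2 : 1 + om * t ^+ 2 != 0.
  apply: contra nz3 => /eqP e; apply/eqP.
  transitivity ((1 + om * t ^+ 2) * (1 + (1 - om) * t ^+ 2)); first by ring: om2.
  by rewrite e mul0r.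
have nz4 : 1 - om ^+ 2 * t ^- 2 != 0.
  apply: contra nz3 => /eqP e; apply/eqP.
  transitivity (t ^+ 2 * (1 - om ^+ 2 * t ^- 2) * (t ^+ 2 + om)); last by rewrite e mulr0 mul0r.
  by field: om2.
have y2' : y ^+ 2 = (t ^+ 2 - 1) * (1 - om ^+ 2 * t ^- 2) by rewrite y2 s02 s12.
have y0 : y != 0 by have := mulf_neq0 nz1 nz4; rewrite -y2' expf_eq0.
have rev_sum a : (a < 3)%N -> _ = ADO om t n w :=
  ADO_reversed om0 om2 t0 nz1 nz2 natr_neq0 n0 hw.
(* The signs [e0 = s0 / t] and [eta = - s0 s1 / om] record which square roots were chosen. *)
have e0_sqr : (s0 / t) ^+ 2 = 1 by rewrite expr_div_n s02 divff // expf_neq0.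
have eta2 : (- (s0 * s1) / om) ^+ 2 = 1.
  by rewrite expr_div_n sqrrN exprMn s02 s12; field; rewrite om0 t0.
have s0E : s0 = s0 / t * t by rewrite mulfVK.
have s1E : s1 = - (s0 / t * (- (s0 * s1) / om) * om / t).
  transitivity (s0 ^+ 2 / t ^+ 2 * s1); last by field; rewrite om0 t0.
  by rewrite s02 divff ?mul1r // expf_neq0.
have four : 4%:R != 0 :> K := natr_neq0 3.
exact: esym (LG_sum om0 om2 t0 nz1 e0_sqr eta2 s0E s1E y0 y2' n0 hw rev_sum four).
Qed.
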